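(* Let $A\in\mathbb{R}^{n\times n}$ with $A=A^\top$ and $b\in\mathbb{R}^n$ be such that $(A,b)$ satisfies the Kalman rank condition. Define the first two normalized eigenvalue coefficients, for $k\in\{1,\ldots,n\}$, by $$\ell_k=\lim_{T\to0^+}T^{-(2k-1)}\lambda_k(T),\qquad r_k=\lim_{T\to0^+}\frac1T\Big(\frac{\lambda_k(T)}{\ell_kT^{2k-1}}-1\Big).$$ Then $r_k=a_k$ for every $k\in\{1,\ldots,n\}$ and $$\beta_k=\sqrt{\frac{\kappa_k\,\ell_{k+1}}{\kappa_{k+1}\,\ell_k}},\qquad k\in\{1,\ldots,n-1\}.$$ Consequently, the scalar coefficients $(\ell_k,r_k)_{1\le k\le n}$ determine the Jacobi representation of the pair $(A,b)$ up to an orthogonal change of coordinates and the unavoidable global sign of $b$ (that is, two such pairs $(A,b)$ and $(A',b')$ with the same coefficients satisfy $A'=OAO^\top$ and $b'=\pm Ob$ for some orthogonal matrix $O$). If the projectors are observed in the original coordinates, set $$\Pi_k^0=\lim_{T\to0^+}\Pi_k(T),\qquad \dot\Pi_k^0=\lim_{T\to0^+}\frac{\Pi_k(T)-\Pi_k^0}{T},\qquad \Pi_0^0=0,\qquad \Pi_n^0=\mathrm{Id}.$$ Then the matrix $A$ itself is reconstructed by $$A=\sum_{k=1}^nr_k\big(\Pi_k^0-\Pi_{k-1}^0\big)+2\sum_{k=1}^{n-1}\dot\Pi_k^0.$$ Moreover, $\|b\|=\sqrt{\ell_1}$ and $\Pi_1^0$ determine $b$ up to its global sign, which cannot be recovered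 from the Gramian.
   Context: $\langle\cdot,\cdot\rangle$ is the Euclidean scalar product on $\mathbb{R}^n$ and $\|\cdot\|$ its norm. The Kalman rank condition is $\operatorname{rank}(b,Ab,\ldots,A^{n-1}b)=n$. For $T>0$, $G_T(A,b)=\int_0^Te^{tA}bb^\top e^{tA^\top}\,dt$ is the controllability Gramian, with eigenvalues ordered decreasingly $\lambda_1(T)\ge\cdots\ge\lambda_n(T)>0$; these are simple for all sufficiently small $T>0$, and for such $T$, $\Pi_k(T)$ denotes the orthogonal projector onto the span of the eigenvectors associated with $\lambda_1(T),\ldots,\lambda_k(T)$. Krylov data: $\mathcal{K}_k(A,b)=\operatorname{span}(b,Ab,\ldots,A^{k-1}b)$, $\mathcal{K}_0(A,b)=\{0\}$. The orthonormal basis $(q_1,\ldots,q_n)$ is obtained by Gram–Schmidt from $b,Ab,\ldots,A^{n-1}b$, characterized by $q_k\in\mathcal{K}_k(A,b)$, $q_k\perp\mathcal{K}_{k-1}(A,b)$, $\langle q_k,A^{k-1}b\rangle>0$. Set $a_k=\langle q_k,Aq_k\rangle$ for $k\in\{1,\ldots,n\}$, $\beta_k=\langle q_{k+1},Aq_k\rangle>0$ for $k\in\{1,\ldots,n-1\}$, and $\kappa_k=\frac{((k-1)!)^2}{(2k-1)!\,(2k-2)!}$. When $A=A^\top$, the matrix of $A$ in the basis $(q_1,\ldots,q_n)$ is symmetric tridiagonal with diagonal entries $a_k$ and adjacent entries $\beta_k$, and $b$ has coordinates $\|b\|e_1$; this is the Jacobi representation of $(A,b)$. *)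

(* Defs.v *)
From HB Require Import structures.
From mathcomp Require Import all_boot all_order all_algebra.
From mathcomp Require Import all_classical all_reals all_analysis.
Set Implicit Arguments.
Unset Strict Implicit.
Unset Printing Implicit Defensive.
Import Order.TTheory GRing.Theory Num.Theory.
Import numFieldNormedType.Exports.
Local Open Scope classical_set_scope.
Local Open Scope ring_scope.

(* Vectors of R^n are column vectors; the indices k below start at 1. *)

Section Gramian.
Variables (R : realType) (n : nat).
Implicit Types (A M U : 'M[R]_n) (b x y : 'cV[R]_n) (k : nat) (T : R).

Definition dotp x y : R := \sum_(i < n) x i 0 * y i 0.

(* The norm `|x| of the library on matrices is the max norm. *)
Definition norm2 x : R := Num.sqrt (dotp x x).

Definition kalman A b : Prop :=
  \rank (\matrix_(i < n, j < n) (A ^+ j *m b) i 0) = n.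

Definition expmx M : 'M[R]_n :=
  limn (series (fun j : nat => (j`!%:R)^-1 *: M ^+ j)).

Definition gramian A b T : 'M[R]_n :=
  \matrix_(i < n, j < n) \int[lebesgue_measure]_(t in `[0, T])
    (expmx (t *: A) *m b *m b^T *m expmx (t *: A^T)) i j.

(* The eigenvalues in decreasing order, repeated according to algebraic
   multiplicity; this list exists and is unique for symmetric M. *)
Definition eigvals M : seq R :=
  xget [::] [set s | sorted >=%R s /\ char_poly M = \prod_(a <- s) ('X - a%:P)].

Definition lambda A b k T : R := nth 0 (eigvals (gramian A b T)) k.-1.

(* The row vectors v with v *m U^T = 0 are those orthogonal to the rows of U,
   so this is the orthogonal projector onto the row space of U; it is
   symmetric, hence acts in the same way on row and on column vectors. *)
Definition orthproj U : 'M[R]_n := proj_mx <<U>>%MS (kermx U^T).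

(* The library's eigenspaces consist of row vectors; the Gramian being
   symmetric, they are the transposes of the column eigenvectors. *)
Definition Pi A b k T : 'M[R]_n :=
  orthproj (\sum_(j < k) eigenspace (gramian A b T) (lambda A b j.+1 T))%MS.

Definition ell A b k : R :=
  lim (T ^- (2 * k - 1) * lambda A b k T @[T --> 0^'+]).

Definition rcoef A b k : R :=
  lim (T^-1 * (lambda A b k T / (ell A b k * T ^+ (2 * k - 1)) - 1)
       @[T --> 0^'+]).

Definition Pi0 A b k : 'M[R]_n :=
  if k == 0%N then 0 else if k == n then 1%:M else
  lim (Pi A b k T @[T --> 0^'+]).

Definition dPi0 A b k : 'M[R]_n :=
  lim (T^-1 *: (Pi A b k T - Pi0 A b k) @[T --> 0^'+]).

(* [:: q_1; ...; q_k], from b, A b, ..., A^(k-1) b; the normalization makes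
   dotp q_j (A ^+ (j - 1) *m b) positive. *)
Fixpoint gram_schmidt A b k : seq 'cV[R]_n :=
  if k is j.+1 then
    let s := gram_schmidt A b j in
    let v := A ^+ j *m b in
    let u := v - \sum_(q <- s) dotp q v *: q in
    rcons s ((norm2 u)^-1 *: u)
  else [::].

Definition krylov_q A b k : 'cV[R]_n := nth 0 (gram_schmidt A b k) k.-1.

Definition jac_a A b k : R := dotp (krylov_q A b k) (A *m krylov_q A b k).

Definition jac_beta A b k : R :=
  dotp (krylov_q A b k.+1) (A *m krylov_q A b k).

End Gramian.

Definition kappa (R : realType) (k : nat) : R :=
  ((k - 1)`! ^ 2)%:R / ((2 * k - 1)`! * (2 * k - 2)`!)%:R.

(* Main.v *)
Require Import Defs.
From HB Require Import structures.
From mathcomp Require Import all_boot all_order all_algebra.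
From mathcomp Require Import all_classical all_reals all_analysis.
From mathcomp Require Import measurable_realfun ring lra zify.
Import Order.TTheory GRing.Theory Num.Theory.
Import numFieldNormedType.Exports.
Local Open Scope classical_set_scope.
Local Open Scope ring_scope.

(** Let [q_0, ..., q_(n-1)] be the Krylov basis, numbered from 0. In this basis [A]
    is a symmetric tridiagonal matrix [J], and [q_i] is orthogonal to the Krylov
    vectors [A^m b] with [m < i], so that
      [<q_i, e^(tA) b> = t^i (c_i + d_i t + O(t^2))].
    Here [c_i = <q_i, A^i b> / i!], and [d_i / c_i] is the mean of
    [J_00, ..., J_ii] because [J] is tridiagonal (lemma [krylov_coord_supdiag]).
    Integrating the products of these functions, the Gramian in the Krylov basis is
    [T D (H_0 + T H_1 + O(T^2)) D] with [D = diag (T^i)], where [H_0] is the Hilbert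
    matrix scaled by the [c_i] (lemma [slope_gram_scaled]).

    The Hilbert matrix is the Gram matrix of the monomials on [0, 1]. Hence the
    matrix [W] of the monic Legendre polynomials, scaled by the [c_i], turns [H_0]
    into [diag (l_k)], where [l_k] is [c_k^2] times the square norm of the Legendre
    polynomial of degree [k] (lemma [legendre_gram_lead]), and the diagonal of
    [W^T H_1 W] is [l_k J_kk] (lemma [legendre_gram_next]). As [W] is unit upper
    triangular, [X = D^-1 W D] is close to the identity for small [T]. The
    eigenvalue problem for the Gramian becomes that of the graded form
    [T D (diag (l_k) + O(T)) D] relative to the metric [X^T X = 1 + O(T)].

    Look for an eigenvalue [T^(2k+1) m]. Multiplying rows and columns by suitable
    powers of [T] turns the difference of the form and of [T^(2k+1) m] times the
    metric into a pencil that tends to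
    [diag (l_0, ..., l_(k-1), l_k - m, -m, ..., -m)]. Its determinant changes sign at
    [m = l_k], so that there is an eigenvalue with [m] close to [l_k]; one for each
    [k] makes the whole spectrum (lemma [eigvals_near]). The adjugate of the singular
    pencil provides the eigenvector. Since the off-diagonal entries of the pencil
    are [O(T)], row [k] of the equation of the kernel gives the next term of the
    eigenvalue, [m = l_k (1 + T J_kk + o(T))] (lemma [slope_eigval]), and the other
    rows give the eigenvector (lemma [slope_eigvec]):
      [q_k + T (J_(k+1,k) q_(k+1) - J_(k,k-1) q_(k-1)) / 2 + o(T)].

    Thus [l_k] and [J_kk] are the two coefficients of the [k]-th eigenvalue, and the
    ratio of consecutive [l_k] gives the entries of [J] next to the diagonal. The
    sum over [i < k] of the projectors on the eigenlines has a telescoping slope,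
    which keeps only the two entries [J_(k,k-1) / 2] of [J / 2] that couple [q_(k-1)]
    and [q_k]; this is the reconstruction formula (lemma [jacobi_decomposition]).
    Finally two pairs with the same [J] and the same norm of [b] are conjugate
    through their Krylov bases, and [b b^T] is [l_0] times the projector on [q_0]. *)

(** * Monic Legendre polynomials on the unit interval *)

Section Legendre.
Context {R : numFieldType}.
Implicit Types (p q U : {poly R}) (a c : R) (i j m : nat).

Definition integ01 p : R := \sum_(i < size p) p`_i / i.+1%:R.

Lemma integ01_widen N p : (size p <= N)%N ->
  integ01 p = \sum_(i < N) p`_i / i.+1%:R.
Proof.
move=> sN; rewrite /integ01 (big_ord_widen _ (fun i => p`_i / i.+1%:R) sN).
rewrite big_mkcond; apply: eq_bigr => i _; case: ltnP => // /leq_sizeP->//.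
by rewrite mul0r.
Qed.

Lemma integ01_is_linear : linear_for *%R integ01.
Proof.
move=> a p q; pose N := maxn (size (a *: p + q)) (maxn (size p) (size q)).
rewrite (@integ01_widen N (_ + q)) ?leq_maxl//.
rewrite (@integ01_widen N p) ?(@integ01_widen N q) ?leq_max ?leqnn ?orbT//.
rewrite mulr_sumr -big_split/=.
by apply: eq_bigr => i _; rewrite coefD coefZ mulrDl mulrA.
Qed.

HB.instance Definition _ := GRing.isLinear.Build R {poly R} R *%R integ01
  integ01_is_linear.

Lemma integ01Z a p : integ01 (a *: p) = a * integ01 p.
Proof. exact: linearZ. Qed.

Lemma integ01Zl a p q : integ01 (a *: p * q) = a * integ01 (p * q).
Proof. by rewrite -[a *: p * q]scalerAl integ01Z. Qed.

Lemma integ01Zr a p q : integ01 (p * (a *: q)) = a * integ01 (p * q).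
Proof. by rewrite -[p * (a *: q)]scalerAr integ01Z. Qed.

Lemma integ01Xn i : integ01 'X^i = i.+1%:R^-1.
Proof.
rewrite (@integ01_widen i.+1) ?size_polyXn// big_ord_recr/= coefXn eqxx mul1r.
rewrite big1 ?add0r// => j _; rewrite coefXn.
by rewrite (_ : _ == _ = false) ?mul0r//; apply/eqP; have := ltn_ord j; lia.
Qed.

Lemma integ01_deriv p : integ01 p^`() = p.[1] - p.[0].
Proof.
rewrite -{1 2 3}[p]coefK !poly_def.
rewrite raddf_sum/= raddf_sum/= !horner_sum -sumrB; apply: eq_bigr => i _.
rewrite derivZ derivXn integ01Z linearMn/= integ01Xn.
rewrite !hornerZ !hornerXn expr1n -mulrBr; congr (_ * _).
case: (nat_of_ord i) => [|k]; first by rewrite mulr0n expr0 subrr.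
by rewrite expr0n/= subr0 -[LHS]mulr_natr mulVf// pnatr_eq0.
Qed.

Lemma integ01_by_parts p q : (p * q).[0] = 0 -> (p * q).[1] = 0 ->
  integ01 (p^`() * q) = - integ01 (p * q^`()).
Proof.
move=> p0 p1; apply/eqP; rewrite -subr_eq0 opprK -linearD/= -derivM.
by rewrite integ01_deriv p0 p1 subrr.
Qed.

Lemma derivn_XsubC_exp a m U j : (j <= m)%N ->
  exists V, (('X - a%:P) ^+ m * U)^`(j) = ('X - a%:P) ^+ (m - j) * V.
Proof.
elim: j => [_|j IH jm]; first by exists U; rewrite subn0.
have [V E] := IH (ltnW jm); rewrite derivnS E.
have -> : (m - j = (m - j.+1).+1)%N by lia.
exists (V *+ (m - j.+1).+1 + ('X - a%:P) * V^`()).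
rewrite derivM deriv_exp derivXsubC/= mulrDr mul1r.
by congr (_ + _); rewrite ?mulrnAl ?mulrnAr// mulrA -exprSr.
Qed.

(** Iterated integration by parts: all boundary terms vanish because 0 and 1
    are zeros of order [m]. *)
Lemma integ01_by_parts_iter m p j : (j <= m)%N ->
  integ01 (('X ^+ m * ('X - 1) ^+ m)^`(j) * p) =
  (-1) ^+ j * integ01 ('X ^+ m * ('X - 1) ^+ m * p^`(j)).
Proof.
elim: j p => [|j IH] p jm; first by rewrite mul1r.
rewrite derivnS integ01_by_parts.
- rewrite IH; last exact: ltnW.
  by rewrite exprS mulN1r mulNr -derivSn.
- have [V E] := @derivn_XsubC_exp 0 m (('X - 1) ^+ m) j (ltnW jm).
  rewrite subr0 in E; rewrite E !hornerM horner_exp hornerX.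
  by rewrite expr0n (_ : _ == _ = false) ?mul0r//; apply/eqP; lia.
- have [V E] := @derivn_XsubC_exp 1 m ('X^m) j (ltnW jm).
  rewrite mulrC in E; rewrite E !hornerM horner_exp hornerXsubC subrr.
  by rewrite expr0n (_ : _ == _ = false) ?mul0r//; apply/eqP; lia.
Qed.

(** Euler's Beta integral, by induction: integrating by parts moves one factor
    [1 - 'X] to a factor ['X]. *)
Lemma integ01_beta i j : integ01 ('X ^+ i * (1 - 'X) ^+ j) =
  (i`! * j`!)%:R / (i + j).+1`!%:R.
Proof.
elim: j i => [|j IH] i.
  rewrite expr0 mulr1 integ01Xn fact0 muln1 addn0 factS natrM invfM.
  by rewrite mulrCA mulfV ?mulr1// pnatr_eq0 -lt0n fact_gt0.
have := @integ01_by_parts ('X ^+ i.+1) ((1 - 'X) ^+ j.+1).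
rewrite !hornerM !horner_exp !hornerE expr0n/= mul0r subrr.
rewrite (expr0n _ j.+1) mulr0 => /(_ erefl erefl).
rewrite derivXn deriv_exp derivB derivX derivC sub0r/= => H.
have E1 : integ01 ('X ^+ i *+ i.+1 * (1 - 'X) ^+ j.+1) =
   i.+1%:R * integ01 ('X ^+ i * (1 - 'X) ^+ j.+1).
  by rewrite mulrnAl linearMn/= mulr_natl.
have E2 : integ01 ('X^(i.+1) * (-1 * (1 - 'X) ^+ j *+ j.+1)) =
   - (j.+1%:R * integ01 ('X ^+ i.+1 * (1 - 'X) ^+ j)).
  by rewrite mulrnAr mulN1r mulrN linearMn/= linearN/= mulNrn mulr_natl.
rewrite E1 E2 opprK IH in H.
apply: (@mulfI _ i.+1%:R); first by rewrite pnatr_eq0.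
rewrite H addSn addnS !factS !natrM.
have f0 k : k`!%:R != 0 :> R by rewrite pnatr_eq0 -lt0n fact_gt0.
have g0 k : k.+1%:R != 0 :> R by rewrite pnatr_eq0.
by field; rewrite f0 -natrD -(natrD _ 1) -(natrD _ 2) !pnatr_eq0.
Qed.

(** Rodrigues' formula, normalized to be monic. *)
Definition legendre m : {poly R} :=
  (m`!%:R / (2 * m)`!%:R) *: ('X ^+ m * ('X - 1) ^+ m)^`(m).

Lemma coef_legendre m i : (legendre m)`_i =
  m`!%:R / (2 * m)`!%:R * ((('X - 1) ^+ m : {poly R})`_i *+ (m + i) ^_ m).
Proof.
rewrite coefZ coef_derivn coefXnM ifN ?addKn//.
by rewrite -leqNgt leq_addr.
Qed.

Lemma coef_legendre_gt m i : (m < i)%N -> (legendre m)`_i = 0.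
Proof.
move=> mi; rewrite coef_legendre nth_default ?mul0rn ?mulr0//.
by rewrite -polyC1 size_exp_XsubC.
Qed.

Lemma size_legendre m : (size (legendre m) <= m.+1)%N.
Proof. by apply/leq_sizeP => j; exact: coef_legendre_gt. Qed.

Lemma coef_legendre_lead m : (legendre m)`_m = 1.
Proof.
have E : (('X - 1 : {poly R}) ^+ m)`_m = 1.
  have := lead_coef_exp ('X - 1 : {poly R}) m.
  by rewrite /lead_coef -polyC1 size_exp_XsubC -/(lead_coef _) lead_coefXsubC expr1n.
rewrite coef_legendre E addnn -mul2n.
have := ffact_fact (leq_addr m m); rewrite addKn addnn -mul2n => <-.
have f0 : m`!%:R != 0 :> R by rewrite pnatr_eq0 -lt0n fact_gt0.
have h0 : ((m + m) ^_ m)%:R != 0 :> R.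
  by rewrite pnatr_eq0 -lt0n ffact_gt0 leq_addr.
by rewrite natrM; field; rewrite f0 mul2n -addnn h0.
Qed.

(** This coefficient is the source of the factor 1/2 in the first-order motion of
    the eigenvectors. *)
Lemma coef_legendre_sublead m : (legendre m.+1)`_m = - (m.+1%:R / 2).
Proof.
have E : (('X - 1 : {poly R}) ^+ m.+1)`_m = - m.+1%:R.
  elim: m => [|m IH]; first by rewrite expr1 coefB coefX coef1 sub0r.
  rewrite exprS mulrBl mul1r coefB coefXM/= IH.
  have := lead_coef_exp ('X - 1 : {poly R}) m.+1.
  rewrite /lead_coef -polyC1 size_exp_XsubC -/(lead_coef _) lead_coefXsubC.
  by rewrite expr1n/= => ->; rewrite -[m.+2%:R]natr1 opprD.
rewrite coef_legendre E.
have := ffact_fact (leq_addr m m.+1); rewrite addKn => F.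
have -> : (2 * m.+1 = (m.+1 + m).+1)%N by lia.
rewrite [in RHS](_ : 2 = (m.+1 + m).+1%:R / m.+1%:R); last first.
  have -> : ((m.+1 + m).+1 = 2 * m.+1)%N by lia.
  by rewrite natrM mulfK// pnatr_eq0.
rewrite (factS (m.+1 + m)) -F (factS m).
have : ((m.+1 + m) ^_ m.+1)%:R != 0 :> R.
  by rewrite pnatr_eq0 -lt0n ffact_gt0 leq_addr.
move: ((m.+1 + m) ^_ m.+1)%N => u u0; rewrite !natrM mulNrn -mulr_natr.
have f0 : m`!%:R != 0 :> R by rewrite pnatr_eq0 -lt0n fact_gt0.
have g0 : m.+1%:R != 0 :> R by rewrite pnatr_eq0.
have : (m.+1 + m).+1%:R != 0 :> R by rewrite pnatr_eq0.
move: (m.+1 + m).+1%:R m.+1%:R g0 => x y y0 x0.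
by field; rewrite f0 u0 x0 y0.
Qed.

(** Square norm of the monic Legendre polynomial of degree [m] on [0, 1]. *)
Definition legendre_sqnorm m : R := m`!%:R ^+ 4 / ((2 * m)`! * (2 * m).+1`!)%:R.

(** After [m] integrations by parts the monomial has been derived [m] times, so
    that only a Beta integral remains, or nothing if its degree is below [m]. *)
Lemma integ01_legendre_Xn_lt m i : (i < m)%N -> integ01 (legendre m * 'X^i) = 0.
Proof.
move=> im; rewrite integ01Zl integ01_by_parts_iter//.
by rewrite derivn_poly0 ?mulr0 ?linear0 ?mulr0// size_polyXn.
Qed.

Lemma Xn_Xsub1_exp m : 'X^m * ('X - 1) ^+ m = (-1) ^+ m *: ('X^m * (1 - 'X) ^+ m) :> {poly R}.
Proof.
rewrite -(opprB 1 'X) -mul_polyC polyC_exp polyCN [X in _ * X = _]exprNn.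
by rewrite mulrCA.
Qed.

Lemma integ01_legendre_Xn m : integ01 (legendre m * 'X^m) = legendre_sqnorm m.
Proof.
rewrite integ01Zl integ01_by_parts_iter//.
rewrite derivnXn ffactnn subnn expr0 Xn_Xsub1_exp integ01Zl.
rewrite signrMK mulr_natr linearMn/= integ01_beta /legendre_sqnorm addnn -mul2n.
rewrite (natrM _ m`! m`!) (natrM _ (2 * m)`!).
have f0 k : k`!%:R != 0 :> R by rewrite pnatr_eq0 -lt0n fact_gt0.
have := f0 (2 * m)%N; have := f0 (2 * m).+1.
move: (2 * m).+1`!%:R (2 * m)`!%:R => x y x0 y0.
by field; rewrite x0 y0.
Qed.

Lemma integ01_legendre_XnS m :
  integ01 (legendre m * 'X^(m.+1)) = m.+1%:R / 2 * legendre_sqnorm m.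
Proof.
rewrite integ01Zl integ01_by_parts_iter//.
have E : (m.+1 ^_ m = m.+1`!)%N by rewrite ffact_factd ?leqnSn// subSnn divn1.
rewrite derivnXn E subSnn Xn_Xsub1_exp integ01Zl.
rewrite signrMK mulrnAr linearMn/= expr1 [_ * 'X]mulrAC -exprSr integ01_beta /legendre_sqnorm.
have -> : ((m.+1 + m).+1`! = 2 * m.+1 * (2 * m).+1`!)%N.
  by rewrite (factS (m.+1 + m)) addSn addnn -mul2n mulnS.
rewrite (factS m) -[_ *+ (m.+1 * _)]mulr_natr.
rewrite (natrM _ (m.+1 * _) m`!) (natrM _ m.+1) (natrM _ (2 * m)`!).
rewrite (natrM _ (2 * m.+1)) (natrM _ 2).
have f0 k : k`!%:R != 0 :> R by rewrite pnatr_eq0 -lt0n fact_gt0.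
have : m.+1%:R != 0 :> R by rewrite pnatr_eq0.
have := f0 (2 * m)%N; have := f0 (2 * m).+1.
move: (2 * m).+1`!%:R (2 * m)`!%:R => x y x0 y0.
move: m.+1%:R => z z0.
by field; rewrite x0 y0 z0.
Qed.

Lemma integ01_legendre_low m p : (size p <= m)%N -> integ01 (legendre m * p) = 0.
Proof.
move=> sp; rewrite -[p]coefK poly_def mulr_sumr linear_sum/= big1// => i _.
rewrite integ01Zr integ01_legendre_Xn_lt ?mulr0//.
exact: leq_trans (ltn_ord i) sp.
Qed.

Lemma integ01_legendreM m j :
  integ01 (legendre m * legendre j) = (m == j)%:R * legendre_sqnorm m.
Proof.
have H k l : (l < k)%N -> integ01 (legendre k * legendre l) = 0.
  by move=> lk; exact/integ01_legendre_low/(leq_trans (size_legendre l)).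
case: (ltngtP m j) => [mj|jm|<-].
- by rewrite mulrC H ?mul0r//.
- by rewrite H ?mul0r//.
rewrite mul1r -integ01_legendre_Xn; apply/eqP; rewrite -subr_eq0 -linearB/= -mulrBr.
rewrite integ01_legendre_low//; apply/leq_sizeP => i; rewrite leq_eqVlt coefB coefXn.
case: eqP => [<- _|_ /= mi]; first by rewrite coef_legendre_lead eqxx subrr.
by rewrite coef_legendre_gt// (gtn_eqF mi) subrr.
Qed.

End Legendre.

(** * Scalar product, spectrum and orthogonal projectors *)

Section Dot.
Context {R : realType} {n : nat}.
Implicit Types (x y z : 'cV[R]_n) (M : 'M[R]_n) (a : R).

Lemma dotpE x y : dotp x y = (x^T *m y) 0 0.
Proof. by rewrite mxE; apply: eq_bigr => i _; rewrite mxE. Qed.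

Lemma dotpC x y : dotp x y = dotp y x.
Proof. by apply: eq_bigr => i _; rewrite mulrC. Qed.

Lemma dotpDr x y z : dotp x (y + z) = dotp x y + dotp x z.
Proof. by rewrite !dotpE mulmxDr mxE. Qed.

Lemma dotpZr a x y : dotp x (a *: y) = a * dotp x y.
Proof. by rewrite !dotpE -scalemxAr mxE. Qed.

Lemma dotpZl a x y : dotp (a *: x) y = a * dotp x y.
Proof. by rewrite dotpC dotpZr dotpC. Qed.

Lemma dotpBr x y z : dotp x (y - z) = dotp x y - dotp x z.
Proof. by rewrite !dotpE mulmxBr !mxE. Qed.

Lemma dotp_sumr (I : Type) (r : seq I) (P : pred I) x (F : I -> 'cV[R]_n) :
  dotp x (\sum_(i <- r | P i) F i) = \sum_(i <- r | P i) dotp x (F i).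
Proof.
by rewrite dotpE mulmx_sumr summxE; apply: eq_bigr => i _; rewrite dotpE.
Qed.

Lemma dotp_mull M x y : dotp (M *m x) y = dotp x (M^T *m y).
Proof. by rewrite !dotpE trmx_mul mulmxA. Qed.

Lemma dotp_ge0 x : 0 <= dotp x x.
Proof. by apply: sumr_ge0 => i _; rewrite -expr2 sqr_ge0. Qed.

Lemma dotp_eq0 x : (dotp x x == 0) = (x == 0).
Proof.
apply/idP/eqP => [|->]; last first.
  by rewrite /dotp big1// => i _; rewrite mxE mul0r.
rewrite psumr_eq0 => [/allP H|i _]; last by rewrite -expr2 sqr_ge0.
apply/matrixP => i j; rewrite ord1 mxE.
by have := H i (mem_index_enum i); rewrite mulf_eq0 orbb => /eqP.
Qed.

Lemma dotp_gt0 x : x != 0 -> 0 < dotp x x.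
Proof. by move=> x0; rewrite lt_neqAle eq_sym dotp_eq0 x0 dotp_ge0. Qed.

Lemma norm2_gt0 x : x != 0 -> 0 < norm2 x.
Proof. by move=> x0; rewrite sqrtr_gt0 dotp_gt0. Qed.

Lemma sqr_norm2 x : norm2 x ^+ 2 = dotp x x.
Proof. by rewrite sqr_sqrtr// dotp_ge0. Qed.

End Dot.

Section Spectrum.
Context {R : realType} {n : nat}.
Implicit Types (G U : 'M[R]_n).

(** [n] distinct roots exhaust the characteristic polynomial, and a decreasing
    list is determined by its multiset of entries. *)
Lemma eigvals_distinct_roots G (s : seq R) :
  sorted >%R s -> size s = n -> all (root (char_poly G)) s -> eigvals G = s.
Proof.
move=> ss sn rs.
have us : uniq s by apply: sorted_uniq ss => [y x z xy yz|x]; [exact: lt_trans yz xy|exact: ltxx].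
have cs : char_poly G = \prod_(a <- s) ('X - a%:P).
  rewrite [LHS](@all_roots_prod_XsubC _ _ s) ?uniq_rootsE ?size_char_poly ?sn//.
  by rewrite (monicP (char_poly_monic G)) scale1r.
have ss' : sorted >=%R s by apply: sub_sorted ss => x y; exact: ltW.
have [] := @xgetPex _ [::] [set s | sorted >=%R s /\
  char_poly G = \prod_(a <- s) ('X - a%:P)]%classic; first by exists s.
rewrite -/(eigvals G) => se ce; apply: (@sorted_eq _ >=%R) => //.
- by move=> y x z xy yz; exact: le_trans yz xy.
- by move=> x y /andP[h1 h2]; apply/le_anti/andP; split.
- by apply: prod_XsubC_eq; rewrite -ce -cs.
Qed.

(** Over the reals no nonzero vector of a subspace is orthogonal to it: this
    makes [orthproj] a projector along the orthogonal complement. *)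
Lemma capmx_orth U : (<<U>> :&: kermx U^T)%MS = 0.
Proof.
apply/eqP/rowV0P => v; rewrite sub_capmx genmxE => /andP[/submxP[w ->] /sub_kermxP].
move=> /(congr1 (fun M => M *m w^T)); rewrite -mulmxA -trmx_mul mul0mx => /matrixP/(_ 0 0).
rewrite mxE [RHS]mxE => H.
have : dotp (w *m U)^T (w *m U)^T = 0.
  by rewrite -H; apply: eq_bigr => i _; rewrite !mxE.
by move/eqP; rewrite dotp_eq0 => /eqP/(congr1 trmx); rewrite trmxK trmx0.
Qed.

(** For a symmetric matrix with a full family of orthogonal eigenvectors, the
    projector onto some of the eigenlines is fixed by its values on that
    family: the identity on the chosen eigenvectors, 0 on the others. *)
Lemma orthproj_eigenspaces G (lam : nat -> R) (V : 'I_n -> 'cV[R]_n) k :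
  G^T = G -> (forall i j : 'I_n, lam i = lam j -> i = j) ->
  (forall i, V i != 0) -> (forall i : 'I_n, G *m V i = lam i *: V i) ->
  (k <= n)%N ->
  orthproj (\sum_(j < k) eigenspace G (lam j))%MS =
  \sum_(i < n | (i < k)%N) (dotp (V i) (V i))^-1 *: (V i *m (V i)^T).
Proof.
move=> Gs lami V0 GV kn; set U := (\sum_(j < k) _)%MS.
have Vo i j : i != j -> dotp (V i) (V j) = 0.
  move=> ij; have : dotp (G *m V i) (V j) = dotp (V i) (G *m V j).
    by rewrite dotp_mull Gs.
  rewrite !GV dotpZl dotpZr => /eqP; rewrite -subr_eq0 -mulrBl mulf_eq0 subr_eq0.
  by case/orP => [/eqP/lami e|/eqP//]; rewrite e eqxx in ij.
have VU (i : 'I_n) : (i < k)%N -> ((V i)^T <= <<U>>)%MS.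
  move=> ik; rewrite genmxE; apply: submx_trans (sumsmx_sup (Ordinal ik) _ (submx_refl _)) => //.
  by apply/eigenspaceP => /=; rewrite -{1}Gs -trmx_mul GV linearZ.
have VK (i : 'I_n) : (k <= i)%N -> ((V i)^T <= kermx U^T)%MS.
  move=> ki; apply/sub_kermxP; rewrite -trmx_mul.
  suff /sub_kermxP -> : (U <= kermx (V i))%MS by rewrite trmx0.
  apply/sumsmx_subP => j _; apply/sub_kermxP; set E := eigenspace _ _.
  have /eigenspaceP EG : (E <= eigenspace G (lam j))%MS by [].
  have : E *m G *m V i = E *m (G *m V i) by rewrite mulmxA.
  rewrite EG GV -scalemxAl -scalemxAr => /eqP.
  rewrite -subr_eq0 -scalerBl scaler_eq0 subr_eq0.
  case/orP => [/eqP e|/eqP//].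
  have jn : (j < n)%N by exact: leq_trans (ltn_ord j) kn.
  have := lami (Ordinal jn) i e; move/(congr1 val) => /= ji.
  by have := ltn_ord j; rewrite ji ltnNge ki.
pose B := \matrix_(i < n) (V i)^T.
have BB : B *m B^T = diag_mx (\row_i dotp (V i) (V i)).
  apply/matrixP => i j; rewrite !mxE.
  transitivity (dotp (V i) (V j)); first by apply: eq_bigr => l _; rewrite !mxE.
  by case: eqVneq => [->|/Vo->]; rewrite ?mulr1n ?mulr0n.
have Bu : B \in unitmx.
  have : B *m B^T \in unitmx.
    rewrite BB unitmxE det_diag unitfE; apply/prodf_neq0 => i _.
    by rewrite mxE dotp_eq0.
  by rewrite unitmx_mul => /andP[].
apply: (can_inj (mulKmx Bu)); apply/row_matrixP => i; rewrite !row_mul rowK.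
rewrite mulmx_sumr; case: (ltnP i k) => ik.
  rewrite proj_mx_id ?capmx_orth ?VU//.
  rewrite (bigD1 i)//= big1 ?addr0 => [|j /andP[_ ji]].
    rewrite -scalemxAr mulmxA [_^T *m _]mx11_scalar -dotpE mul_scalar_mx.
    by rewrite scalerA mulVf ?scale1r// dotp_eq0.
  by rewrite -scalemxAr mulmxA [_^T *m _]mx11_scalar -dotpE mul_scalar_mx (Vo i j) 1?eq_sym//
    scale0r scaler0.
rewrite proj_mx_0 ?capmx_orth ?VK// big1// => j jk.
rewrite -scalemxAr mulmxA [_^T *m _]mx11_scalar -dotpE mul_scalar_mx (Vo i j) ?scale0r ?scaler0//.
by apply/eqP => ij; rewrite -ij ltnNge ik in jk.
Qed.

End Spectrum.

(** * Gram-Schmidt basis of the Krylov spaces *)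

Section Krylov.
Context {R : realType} {n : nat} (A : 'M[R]_n) (b : 'cV[R]_n).
Implicit Types (x y : 'cV[R]_n) (i j k m : nat).

(** Membership in the [k]-th Krylov space, with the coefficients indexed by [nat]
    so that they can be extended and truncated freely. *)
Definition in_krylov k x :=
  exists c : nat -> R, x = \sum_(i < k) c i *: (A ^+ i *m b).

Lemma in_krylov_comb k (I : Type) (r : seq I) (P : pred I) (a : I -> R)
    (F : I -> 'cV[R]_n) : (forall z : I, P z -> in_krylov k (F z)) ->
  in_krylov k (\sum_(z <- r | P z) a z *: F z).
Proof.
move=> H; elim/big_rec: _ => [|i x Pi [c ->]].
  by exists (fun=> 0); rewrite big1// => i _; rewrite scale0r.
have [d ->] := H i Pi; exists (fun j => a i * d j + c j).
rewrite scaler_sumr -big_split/=.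
by apply: eq_bigr => j _; rewrite scalerDl scalerA.
Qed.

Lemma in_krylov_le k l x : (k <= l)%N -> in_krylov k x -> in_krylov l x.
Proof.
move=> kl [c ->]; exists (fun i => if (i < k)%N then c i else 0).
rewrite (big_ord_widen _ (fun i => c i *: (A ^+ i *m b)) kl) big_mkcond/=.
by apply: eq_bigr => i _; case: ifP => //; rewrite scale0r.
Qed.

Lemma in_krylov_pow k i : (i < k)%N -> in_krylov k (A ^+ i *m b).
Proof.
move=> ik; exists (fun j => (j == i)%:R); rewrite (bigD1 (Ordinal ik))//= eqxx scale1r.
rewrite big1 ?addr0// => j; rewrite -val_eqE/= => /negbTE->.
by rewrite scale0r.
Qed.

Lemma in_krylovD k x y : in_krylov k x -> in_krylov k y -> in_krylov k (x + y).
Proof.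
move=> hx hy; have -> : x + y = \sum_(c : bool) 1 *: (if c then x else y).
  by rewrite big_bool/= !scale1r.
by apply: in_krylov_comb => -[].
Qed.

Lemma in_krylovZ k a x : in_krylov k x -> in_krylov k (a *: x).
Proof.
move=> hx; have -> : a *: x = \sum_(i < 1) a *: x by rewrite big_ord1.
exact: in_krylov_comb.
Qed.

Lemma in_krylovM k x : in_krylov k x -> in_krylov k.+1 (A *m x).
Proof.
move=> [c ->]; rewrite mulmx_sumr.
have -> : \sum_(i < k) A *m (c i *: (A ^+ i *m b)) =
          \sum_(i < k) c i *: (A ^+ i.+1 *m b).
  by apply: eq_bigr => i _; rewrite -scalemxAr mulmxA exprS.
by apply: in_krylov_comb => i _; apply: in_krylov_pow; rewrite ltnS.
Qed.

Hypothesis Ab_kalman : kalman A b.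

(** A relation expressing [A ^+ j *m b] by lower powers is a nonzero vector of
    the kernel of the Kalman matrix. *)
Lemma kalman_free j : (j < n)%N -> ~ in_krylov j (A ^+ j *m b).
Proof.
move=> jn [c E]; set K := \matrix_(i < n, j < n) (A ^+ j *m b) i 0.
have Ku : K \in unitmx by rewrite -row_full_unit; apply/eqP.
pose z : 'cV[R]_n := \col_i (if (i < j)%N then - c i else (i == j :> nat)%:R).
have : K *m z = 0.
  apply/matrixP => r s; rewrite ord1 !mxE.
  pose F i := (A ^+ i *m b) r 0 * (if (i < j)%N then - c i else (i == j)%:R).
  rewrite (eq_bigr (fun i : 'I_n => F i)); last by move=> i _; rewrite [K _ _]mxE [z _ _]mxE.
  have E2 : (A ^+ j *m b) r 0 = \sum_(i < j) c i * (A ^+ i *m b) r 0.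
    by rewrite E summxE; apply: eq_bigr => i _; rewrite mxE.
  rewrite (bigID (fun i : 'I_n => (i < j.+1)%N))/= [X in _ + X]big1 ?addr0; last first.
    move=> i; rewrite -leqNgt => ji; rewrite /F ifN; last by rewrite -leqNgt ltnW.
    by rewrite gtn_eqF ?mulr0.
  rewrite -(big_ord_widen _ F jn) big_ord_recr/= {2}/F ltnn eqxx mulr1 E2.
  rewrite -big_split/= big1// => i _.
  by rewrite /F ltn_ord mulrN mulrC addrC subrr.
move=> /(congr1 (mulmx (invmx K))); rewrite mulKmx// mulmx0.
by move=> /matrixP/(_ (Ordinal jn) 0)/eqP; rewrite !mxE ltnn eqxx oner_eq0.
Qed.

Let q i := krylov_q A b i.+1.
Let u i := A ^+ i *m b - \sum_(j < i) dotp (q j) (A ^+ i *m b) *: q j.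

(** The Gram-Schmidt lists are prefixes of each other. *)
Lemma gram_schmidtE k : gram_schmidt A b k = mkseq q k.
Proof.
elim: k => [//|k IH]; rewrite /mkseq -[in RHS](addn1 k) iotaD map_cat -/(mkseq q k) cats1 -IH.
have sk : size (gram_schmidt A b k) = k by rewrite IH size_mkseq.
rewrite add0n /q /krylov_q /=; congr rcons.
by rewrite nth_rcons sk ltnn eqxx.
Qed.

Lemma krylov_qE i : q i = (norm2 (u i))^-1 *: u i.
Proof.
rewrite {1}/q /krylov_q/= nth_rcons gram_schmidtE size_mkseq ltnn eqxx.
suff <- : A ^+ i *m b - \sum_(q0 <- mkseq q i) dotp q0 (A ^+ i *m b) *: q0 = u i by [].
have -> : mkseq q i = [seq q j | j <- index_iota 0 i] by rewrite /index_iota subn0.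
by rewrite big_map big_mkord.
Qed.

Lemma in_krylov_residual i : (forall j, (j < i)%N -> in_krylov i (q j)) -> in_krylov i.+1 (u i).
Proof.
move=> H; rewrite /u -scaleN1r; apply: in_krylovD; first exact: in_krylov_pow.
apply/in_krylovZ/in_krylov_comb => j _; apply: in_krylov_le (leqnSn i) _.
exact/H.
Qed.

Lemma in_krylov_q i : in_krylov i.+1 (q i).
Proof.
elim/ltn_ind: i => i IH; rewrite krylov_qE; apply/in_krylovZ/in_krylov_residual => j ji.
by apply: in_krylov_le (IH j ji).
Qed.

Lemma krylov_residual_neq0 i : (i < n)%N -> u i != 0.
Proof.
move=> lt_in; apply/eqP => /eqP; rewrite subr_eq0 => /eqP E.
apply: (kalman_free _ lt_in); rewrite E; apply: in_krylov_comb => j _.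
by apply: in_krylov_le (in_krylov_q j).
Qed.

Lemma krylov_pow_expand i : (i < n)%N ->
  A ^+ i *m b = norm2 (u i) *: q i + \sum_(j < i) dotp (q j) (A ^+ i *m b) *: q j.
Proof.
move=> lt_in; rewrite krylov_qE scalerA mulfV ?scale1r ?subrK//.
by rewrite gt_eqF// norm2_gt0// krylov_residual_neq0.
Qed.

Lemma krylov_q_orthonormal i j : (i < n)%N -> (j < n)%N ->
  dotp (q i) (q j) = (i == j)%:R.
Proof.
suff H k : (k < n)%N -> (dotp (q k) (q k) = 1) /\ (forall l, (l < k)%N -> dotp (q l) (q k) = 0).
  move=> lt_in jn; case: ltngtP => [ij|ji|<-].
  - by have [_ ->] := H j jn.
  - by rewrite dotpC; have [_ ->] := H i lt_in.
  - by have [-> _] := H i lt_in.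
elim/ltn_ind: k => k IH kn; split => [|l lk].
  rewrite krylov_qE dotpZl dotpZr mulrA -invfM -expr2 sqr_norm2 mulVf//.
  by rewrite dotp_eq0 krylov_residual_neq0.
rewrite (krylov_qE k) dotpZr; apply/eqP; rewrite mulf_eq0; apply/orP; right.
rewrite dotpBr dotp_sumr (bigD1 (Ordinal lk))//= dotpZr.
have [-> _] := IH l lk (ltn_trans lk kn).
rewrite mulr1 big1 ?addr0 ?subrr// => m ml; rewrite dotpZr.
have mn := ltn_trans (ltn_ord m) kn.
suff -> : dotp (q l) (q m) = 0 by rewrite mulr0.
have : m != l :> nat by rewrite -(inj_eq val_inj) in ml.
rewrite neq_ltn => /orP[ml'|lm].
  by rewrite dotpC; have [_ ->] := IH l lk (ltn_trans lk kn).
by have [_ ->] := IH m (ltn_ord m) mn.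
Qed.

Lemma krylov_q_orth i x : (i < n)%N -> in_krylov i x -> dotp (q i) x = 0.
Proof.
move=> lt_in [c ->]; rewrite dotp_sumr big1// => j _; rewrite dotpZr.
have jn := ltn_trans (ltn_ord j) lt_in.
rewrite krylov_pow_expand// dotpDr dotpZr dotp_sumr krylov_q_orthonormal// gtn_eqF// mulr0 add0r.
rewrite big1 ?mulr0// => l _; rewrite dotpZr krylov_q_orthonormal//; last exact: ltn_trans jn.
by rewrite gtn_eqF ?mulr0//; exact: ltn_trans (ltn_ord j).
Qed.

(** Since the [q i] are indexed from 0, [g] and [J] hold the coordinates of the
    Krylov vectors and the Jacobi matrix of the pair, with ordinals as indices. *)
Let g i m := dotp (q i) (A ^+ m *m b).
Let J i j := dotp (q i) (A *m q j).

Lemma krylov_coord_low i m : (m < i)%N -> (i < n)%N -> g i m = 0.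
Proof. by move=> mi lt_in; apply: krylov_q_orth => //; exact: in_krylov_pow. Qed.

Lemma krylov_coord_diag_gt0 i : (i < n)%N -> 0 < g i i.
Proof.
move=> lt_in; rewrite /g krylov_pow_expand// dotpDr dotpZr krylov_q_orthonormal// eqxx mulr1.
rewrite dotp_sumr big1 ?addr0 ?norm2_gt0 ?krylov_residual_neq0// => j _.
rewrite dotpZr krylov_q_orthonormal//; last exact: ltn_trans lt_in.
by rewrite gtn_eqF ?mulr0.
Qed.

Definition krylov_mx : 'M[R]_n := \matrix_(r, i) q i r 0.

Lemma col_krylov_mx (i : 'I_n) : col i krylov_mx = q i.
Proof. by apply/matrixP => r s; rewrite ord1 !mxE. Qed.

Lemma krylov_mx_trK : krylov_mx^T *m krylov_mx = 1%:M.
Proof.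
apply/matrixP => i j; rewrite mxE [RHS]mxE.
have := @krylov_q_orthonormal i j (ltn_ord i) (ltn_ord j).
rewrite (inj_eq val_inj) => <-.
by apply: eq_bigr => l _; rewrite [krylov_mx^T _ _]mxE [krylov_mx _ _]mxE [krylov_mx l _]mxE.
Qed.

Lemma krylov_mxK : krylov_mx *m krylov_mx^T = 1%:M.
Proof. exact: mulmx1C krylov_mx_trK. Qed.

Lemma krylov_mx_tr_mulE x (i : 'I_n) : (krylov_mx^T *m x) i 0 = dotp (q i) x.
Proof. by rewrite mxE; apply: eq_bigr => r _; rewrite !mxE. Qed.

Lemma dotp_krylov_expand x y : dotp x y = \sum_(l < n) dotp (q l) x * dotp (q l) y.
Proof.
rewrite dotpE -[x^T]mulmx1 -krylov_mxK mulmxA -mulmxA mxE.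
apply: eq_bigr => l _; rewrite krylov_mx_tr_mulE; congr (_ * _).
by rewrite mxE; apply: eq_bigr => r _; rewrite !mxE mulrC.
Qed.

Hypothesis A_sym : A = A^T.

Lemma jacobi_sym i j : J i j = J j i.
Proof. by rewrite /J dotpC dotp_mull -A_sym. Qed.

(** [A *m q j] lies in the Krylov space of dimension [j.+2], to which [q i] is
    orthogonal for [i > j.+1]; symmetry gives the other half. *)
Lemma jacobi_tridiag i j : (i < n)%N -> (j < n)%N -> (j.+1 < i)%N || (i.+1 < j)%N ->
  J i j = 0.
Proof.
have H k l : (k < n)%N -> (l.+1 < k)%N -> J k l = 0.
  move=> kn lk; apply: krylov_q_orth => //; apply: in_krylov_le (lk) _.
  exact/in_krylovM/in_krylov_q.
by move=> lt_in jn /orP[|] h; [|rewrite jacobi_sym]; apply: H.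
Qed.

Lemma krylov_coordS i m : g i m.+1 = \sum_(l < n) J i l * g l m.
Proof.
have -> : g i m.+1 = dotp (A *m q i) (A ^+ m *m b).
  by rewrite dotp_mull -A_sym /g exprS -mulmxA.
rewrite dotp_krylov_expand; apply: eq_bigr => l _; congr (_ * _).
by rewrite -/(J _ _) jacobi_sym.
Qed.

(** Only the entry of [J] next to the diagonal meets a nonzero coordinate. *)
Lemma krylov_coord_diagS i : (i.+1 < n)%N -> g i.+1 i.+1 = J i.+1 i * g i i.
Proof.
move=> lt_in; rewrite krylov_coordS (bigD1 (Ordinal (ltnW lt_in)))//= big1 ?addr0//.
move=> j; rewrite -val_eqE/= neq_ltn => /orP[ji|ij].
  by rewrite jacobi_tridiag ?mul0r// ltnS ji.
by rewrite (krylov_coord_low _ _ ij) ?mulr0.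
Qed.

(** A path of length [i.+1] from 0 to [i] in the tridiagonal matrix [J] makes one
    stop, at any [j <= i]; all such paths cross the same off-diagonal entries,
    whose product is [g i i] up to the norm of [b]. *)
Lemma krylov_coord_supdiag i : (i < n)%N ->
  g i i.+1 = g i i * \sum_(j < i.+1) J j j.
Proof.
elim: i => [|i IH] lt_in.
  rewrite big_ord1 krylov_coordS (bigD1 (Ordinal lt_in))//= big1 ?addr0 1?mulrC//.
  move=> j; rewrite -val_eqE/= -lt0n => j0.
  by rewrite krylov_coord_low ?mulr0.
rewrite krylov_coordS (bigD1 (Ordinal lt_in))//= (bigD1 (Ordinal (ltnW lt_in)))/=; last first.
  by rewrite -val_eqE/= ltn_eqF.
rewrite big1 ?addr0.
  rewrite IH ?(ltnW lt_in)// [in RHS]big_ord_recr/= mulrDr addrC.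
  by congr (_ + _); [rewrite mulrA -krylov_coord_diagS|rewrite mulrC].
move=> j; rewrite -!val_eqE/= => /andP[ji1 ji].
have [h|h] := ltnP j i; first by rewrite jacobi_tridiag ?mul0r// ltnS h.
by rewrite krylov_coord_low ?mulr0//; lia.
Qed.

Lemma krylov_q0 : (0 < n)%N -> b = norm2 b *: q 0.
Proof.
move=> n0; have := @krylov_pow_expand 0 n0; rewrite big_ord0 addr0 expr0 /u.
by rewrite big_ord0 subr0 expr0 !mul1mx.
Qed.

Lemma krylov_coord0 : (0 < n)%N -> g 0 0 = norm2 b.
Proof.
move=> n0; rewrite /g expr0 mul1mx {1}(krylov_q0 n0) dotpZr.
by rewrite krylov_q_orthonormal// eqxx mulr1.
Qed.

End Krylov.

(** * Limits of matrices and right slopes at 0 *)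

Section MatrixLimits.
Context {R : realType} {X : Type} {F : set_system X} {FF : Filter F}.

Lemma cvg_near_eq (U : topologicalType) (f g : X -> U) (a : U) :
  (\forall x \near F, f x = g x) -> g x @[x --> F] --> a -> f x @[x --> F] --> a.
Proof.
by move=> fg; apply: cvg_trans; apply: near_eq_cvg; apply: filterS fg => x ->.
Qed.

(** The topology of matrices is that of the max norm. *)
Lemma cvg_mxP m n (f : X -> 'M[R]_(m, n)) (a : 'M[R]_(m, n)) :
  (f x @[x --> F] --> a) <-> (forall i j, f x i j @[x --> F] --> a i j).
Proof.
split=> [fa i j|H].
  apply: (@cvg_comp _ _ _ f (fun M : 'M[R]_(m, n) => M i j) _ _ _ fa).
  exact: (@coord_continuous R m n i j a).
apply/cvgrPdist_lt => e e0.
suff : \forall x \near F, forall i j, `|a i j - f x i j| < e.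
  apply: filterS => x Hx; rewrite [ltLHS]mx_normrE.
  by apply/bigmax_ltP; split => // -[i j] _; rewrite !mxE /= Hx.
apply: filter_forall => i; apply: filter_forall => j.
by move: e e0; apply/cvgrPdist_lt/H.
Qed.

Lemma cvg_mx_entry m n (f : X -> 'M[R]_(m, n)) (a : 'M[R]_(m, n)) :
  f x @[x --> F] --> a -> forall i j, f x i j @[x --> F] --> a i j.
Proof. by move=> fa; apply/cvg_mxP. Qed.

Lemma cvg_sum (I : Type) (r : seq I) (P : pred I) (V : normedModType R)
    (f : I -> X -> V) (a : I -> V) : (forall i, P i -> f i x @[x --> F] --> a i) ->
  \sum_(i <- r | P i) f i x @[x --> F] --> \sum_(i <- r | P i) a i.
Proof. by move=> H; apply: cvg_big => //; exact: add_continuous. Qed.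

Lemma cvg_prod (I : Type) (r : seq I) (P : pred I) (f : I -> X -> R) (a : I -> R) :
  (forall i, P i -> f i x @[x --> F] --> a i) ->
  \prod_(i <- r | P i) f i x @[x --> F] --> \prod_(i <- r | P i) a i.
Proof. by move=> H; apply: cvg_big => //; exact: mul_continuous. Qed.

Lemma cvg_mulmx m n p (f : X -> 'M[R]_(m, n)) (g : X -> 'M[R]_(n, p)) (a : 'M[R]_(m, n))
    (c : 'M[R]_(n, p)) :
  f x @[x --> F] --> a -> g x @[x --> F] --> c -> f x *m g x @[x --> F] --> a *m c.
Proof.
move=> /cvg_mxP fa /cvg_mxP gc; apply/cvg_mxP => i j; rewrite mxE.
under eq_fun do rewrite mxE.
by apply: cvg_sum => l _; apply: cvgM.
Qed.

Lemma cvg_trmx m n (f : X -> 'M[R]_(m, n)) (a : 'M[R]_(m, n)) :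
  f x @[x --> F] --> a -> (f x)^T @[x --> F] --> a^T.
Proof.
move=> /cvg_mxP fa; apply/cvg_mxP => i j; rewrite mxE.
under eq_fun do rewrite mxE.
exact: fa.
Qed.

Lemma cvg_det n (f : X -> 'M[R]_n) (a : 'M[R]_n) :
  f x @[x --> F] --> a -> \det (f x) @[x --> F] --> \det a.
Proof.
move=> /cvg_mxP fa; apply: cvg_sum => s _; apply: cvgM; first exact: cvg_cst.
by apply: cvg_prod => i _; exact: fa.
Qed.

Lemma cvg_adj n (f : X -> 'M[R]_n) (a : 'M[R]_n) :
  f x @[x --> F] --> a -> \adj (f x) @[x --> F] --> \adj a.
Proof.
move=> /cvg_mxP fa; apply/cvg_mxP => i j; rewrite mxE.
under eq_fun do rewrite mxE.
apply: cvgM; first exact: cvg_cst.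
apply/cvg_det/cvg_mxP => r s; rewrite !mxE; under eq_fun do rewrite !mxE.
exact: fa.
Qed.

End MatrixLimits.

Section RightLimits.
Context {R : realType}.

Lemma cvg_at_right_expr (e : nat) : T ^+ e @[T --> (0 : R)^'+] --> (0 : R) ^+ e.
Proof. by apply/cvg_at_right_filter/exprn_continuous. Qed.

Lemma cvg_of_slope (V : normedModType R) (f : R -> V) (a d : V) :
  T^-1 *: (f T - a) @[T --> 0^'+] --> d -> f T @[T --> 0^'+] --> a.
Proof.
move=> H; apply: (cvg_near_eq _ _ (fun T => a + T *: (T^-1 *: (f T - a)))).
  by apply: filterS (nbhs_right_neq 0) => T T0; rewrite scalerA mulfV ?scale1r ?subrKC.
rewrite -[X in _ --> X]addr0 -(scale0r d); apply: cvgD; first exact: cvg_cst.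
apply: cvgZ => //; have := cvg_at_right_expr 1; exact.
Qed.

Lemma cvg_slope_mulmx m n p (f : R -> 'M[R]_(m, n)) (g : R -> 'M[R]_(n, p))
    (a a' : 'M[R]_(m, n)) (c c' : 'M[R]_(n, p)) :
  T^-1 *: (f T - a) @[T --> 0^'+] --> a' -> T^-1 *: (g T - c) @[T --> 0^'+] --> c' ->
  T^-1 *: (f T *m g T - a *m c) @[T --> 0^'+] --> a' *m c + a *m c'.
Proof.
move=> fa gc; have E T : T^-1 *: (f T *m g T - a *m c) =
    (T^-1 *: (f T - a)) *m g T + a *m (T^-1 *: (g T - c)).
  rewrite -scalemxAl -scalemxAr -scalerDr mulmxBl mulmxBr.
  by rewrite addrA subrK.
under eq_fun do rewrite E.
apply: cvgD; first by apply: cvg_mulmx => //; exact: cvg_of_slope gc.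
by apply: cvg_mulmx => //; exact: cvg_cst.
Qed.

Lemma cvg_slope_trmx m n (f : R -> 'M[R]_(m, n)) (a a' : 'M[R]_(m, n)) :
  T^-1 *: (f T - a) @[T --> 0^'+] --> a' ->
  T^-1 *: ((f T)^T - a^T) @[T --> 0^'+] --> a'^T.
Proof. by move=> /cvg_trmx; under eq_fun do rewrite linearZ/= linearB/=. Qed.

End RightLimits.

Lemma horner_char_poly (R : comNzRingType) n (M : 'M[R]_n) a :
  (char_poly M).[a] = \det (a%:M - M).
Proof.
rewrite /char_poly -horner_evalE -det_map_mx; congr (\det _).
apply/matrixP => i j; rewrite !mxE /= /horner_eval hornerD hornerN hornerMn hornerX.
by rewrite hornerC.
Qed.

(** * Spectrum of a graded matrix *)

Section Graded.
Context {R : realType} {n : nat} (l : nat -> R) (G Z Hh S : R -> 'M[R]_n).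
Implicit Types (k : 'I_n) (m T : R).

(** In the basis [Z T] the quadratic form [G T] becomes a matrix graded by powers
    of [T], and the Euclidean metric becomes [S T]. *)
Definition graded_at T :=
  [/\ 0 < T, Z T \in unitmx, (Z T)^T *m Z T = S T &
      (Z T)^T *m G T *m Z T = \matrix_(i, j) (T ^+ (i + j).+1 * Hh T i j)].

(** Rows and columns of index less than [k] are too large at the scale of the
    [k]-th eigenvalue; these factors bring them back to order 1. *)
Definition rescale k T : 'M[R]_n := diag_mx (\row_i T ^+ (k - i)%N).

Definition pencil k m T : 'M[R]_n :=
  \matrix_(i, j) (T ^+ ((i - k) + (j - k)) * Hh T i j
                  - m * T ^+ ((k - i) + (k - j)) * S T i j).

(** The limit of [pencil k m T] as [T] tends to [0^'+]. It is diagonal: at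
    indices less than [k] only the form survives, at larger ones only the
    metric. *)
Definition pencil0 k m : 'M[R]_n :=
  diag_mx (\row_i if (i < k)%N then l i else if i == k then l k - m else - m).

Lemma pencilE k m T : graded_at T ->
  rescale k T *m (Z T)^T *m (G T - (T ^+ (2 * k).+1 * m)%:M) *m Z T *m rescale k T =
  T ^+ (2 * k).+1 *: pencil k m T.
Proof.
move=> [T0 _ ZZ ZGZ].
have -> : rescale k T *m (Z T)^T *m (G T - (T ^+ (2 * k).+1 * m)%:M) *m Z T *m rescale k T
  = rescale k T *m ((Z T)^T *m G T *m Z T - (T ^+ (2 * k).+1 * m) *: S T) *m rescale k T.
  by rewrite -ZZ !(mulmxBr, mulmxBl) mul_mx_scalar -!(scalemxAr, scalemxAl) !mulmxA.
rewrite ZGZ; apply/matrixP => i j.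
rewrite mul_mx_diag mul_diag_mx !mxE.
rewrite !(mulrBr, mulrBl) !mulrA; congr (_ - _).
  rewrite [LHS]mulrAC -!exprD; congr (T ^+ _ * _).
  by lia.
by rewrite [T ^+ (k - i + _)]exprD; ring.
Qed.

Lemma det_rescale_gt0 k T : 0 < T -> 0 < \det (rescale k T).
Proof.
by move=> T0; rewrite det_diag; apply: prodr_gt0 => i _; rewrite mxE exprn_gt0.
Qed.

(** The identity [pencilE] is a congruence up to a scalar, and its determinant
    compares the characteristic polynomial with that of the pencil. *)
Lemma char_poly_pencil k T : graded_at T ->
  exists2 C, C != 0 & forall m,
    (char_poly (G T)).[T ^+ (2 * k).+1 * m] = C * \det (pencil k m T).
Proof.
move=> gT; have [T0 Zu _ _] := gT.
have r0 := lt0r_neq0 (det_rescale_gt0 k T T0).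
have z0 : \det (Z T) != 0 by rewrite -unitfE -unitmxE.
exists ((-1) ^+ n * (T ^+ (2 * k).+1) ^+ n / (\det (rescale k T) * \det (Z T)) ^+ 2) => [|m].
  rewrite mulf_neq0 ?invr_neq0 ?(expf_neq0 _ (mulf_neq0 _ _))//.
  by rewrite mulf_neq0 ?expf_neq0 ?oppr_eq0 ?oner_eq0 ?gt_eqF.
have := congr1 determinant (pencilE k m T gT).
rewrite detZ !det_mulmx det_tr horner_char_poly => E.
have -> : \det ((T ^+ (2 * k).+1 * m)%:M - G T) =
    (-1) ^+ n * \det (G T - (T ^+ (2 * k).+1 * m)%:M).
  by rewrite -detZ scaleN1r opprB.
rewrite mulrAC -[_ * _ * \det (pencil _ _ _)]mulrA -E.
have rz0 : (\det (rescale k T) * \det (Z T)) ^+ 2 != 0.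
  by rewrite expf_neq0// mulf_neq0.
apply: (canRL (mulfK rz0)); ring.
Qed.

Lemma root_pencil k m T : graded_at T ->
  root (char_poly (G T)) (T ^+ (2 * k).+1 * m) = (\det (pencil k m T) == 0).
Proof.
by move=> /(char_poly_pencil k)[C C0 E]; rewrite rootE E mulf_eq0 (negbTE C0).
Qed.

(** Since the pencil is congruent to [G T - T ^+ (2 * k).+1 * m], its kernel
    yields eigenvectors. *)
Lemma pencil_ker_eigenvector k m T (w : 'cV[R]_n) : graded_at T ->
  pencil k m T *m w = 0 ->
  let v := Z T *m (rescale k T *m w) in
  G T *m v = (T ^+ (2 * k).+1 * m) *: v.
Proof.
move=> gT pw v; have [T0 Zu _ _] := gT.
have ru : rescale k T \in unitmx.
  by rewrite unitmxE unitfE gt_eqF// det_rescale_gt0.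
have : rescale k T *m (Z T)^T *m ((G T - (T ^+ (2 * k).+1 * m)%:M) *m v) = 0.
  have := congr1 (mulmx^~ w) (pencilE k m T gT).
  by rewrite -scalemxAl pw scaler0 /v !mulmxA.
move=> /(congr1 (mulmx (invmx (rescale k T *m (Z T)^T)))).
rewrite mulmx0 mulKmx ?unitmx_mul ?ru ?unitmx_tr//.
by rewrite mulmxBl mul_scalar_mx => /eqP; rewrite subr_eq0 => /eqP.
Qed.

Hypothesis l_gt0 : forall k, 0 < l k.
Hypothesis gradedT : \forall T \near 0^'+, graded_at T.
Hypothesis cvgH : Hh T @[T --> 0^'+] --> diag_mx (\row_(i < n) l i).
Hypothesis cvgS : S T @[T --> 0^'+] --> (1%:M : 'M[R]_n).

Lemma cvg_pencil k (m : R -> R) (m0 : R) : m T @[T --> 0^'+] --> m0 ->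
  pencil k (m T) T @[T --> 0^'+] --> pencil0 k m0.
Proof.
move=> cm; apply/cvg_mxP => i j; under eq_fun do rewrite mxE.
have -> : pencil0 k m0 i j =
    0 ^+ ((i - k) + (j - k)) * (diag_mx (\row_(i < n) l i)) i j
    - m0 * 0 ^+ ((k - i) + (k - j)) * (1%:M : 'M[R]_n) i j.
  rewrite !mxE; case: (eqVneq i j) => [<-|_]; last by rewrite !mulr0n !mulr0 subr0.
  rewrite !mulr1n mulr1 !expr0n !addnn !double_eq0 !subn_eq0 -val_eqE/=.
  by case: ltngtP => [ik|ki|->]; rewrite ?mulr1 ?mul1r ?mul0r ?mulr0 ?sub0r ?subr0.
move/cvg_mxP: cvgH => /(_ i j) cH; move/cvg_mxP: cvgS => /(_ i j) cS.
apply: cvgB; first by apply: cvgM => //; exact: cvg_at_right_expr.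
by apply: cvgM => //; apply: cvgM => //; exact: cvg_at_right_expr.
Qed.

(** The determinants of the limit pencils at [l k + e] and [l k - e] have opposite
    signs, so by continuity those of the pencils do too for small [T]; the
    intermediate value theorem for polynomials gives a root in between. *)
Lemma eigenvalue_near k (e : R) : 0 < e -> e < l k ->
  \forall T \near 0^'+, exists2 m, `|m - l k| <= e &
    root (char_poly (G T)) (T ^+ (2 * k).+1 * m).
Proof.
move=> e0 elk.
have : \det (pencil k (l k + e) T) * \det (pencil k (l k - e) T) @[T --> 0^'+] -->
       \det (pencil0 k (l k + e)) * \det (pencil0 k (l k - e)).
  by apply: cvgM; apply: cvg_det; apply: (cvg_pencil k (fun=> _)); apply: cvg_cst.
have neg : \det (pencil0 k (l k + e)) * \det (pencil0 k (l k - e)) < 0.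
  rewrite !det_diag -big_split (bigD1 k)//= pmulr_llt0.
    by rewrite !mxE ltnn eqxx; nra.
  apply: prodr_gt0 => i ik; rewrite !mxE (negbTE ik).
  by case: ifP => _; have := l_gt0 i; have := l_gt0 k; nra.
move=> /(cvgr_lt _)/(_ _ neg) H; apply: filterS2 gradedT H => T gT dd.
have T0 : 0 < T by case: gT.
have [C C0 E] := char_poly_pencil k T gT.
pose p := char_poly (G T).
have pp : p.[T ^+ (2 * k).+1 * (l k + e)] * p.[T ^+ (2 * k).+1 * (l k - e)] < 0.
  rewrite !E mulrACA pmulr_rlt0// -expr2 lt_neqAle eq_sym sqrf_eq0 C0 sqr_ge0//.
have le12 : T ^+ (2 * k).+1 * (l k - e) <= T ^+ (2 * k).+1 * (l k + e).
  by rewrite ler_pM2l ?exprn_gt0//; lra.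
suff [x /andP[x1 x2] rx] : exists2 x, T ^+ (2 * k).+1 * (l k - e) <= x
    <= T ^+ (2 * k).+1 * (l k + e) & root p x.
  exists (x / T ^+ (2 * k).+1); last first.
    by rewrite mulrC divfK// expf_neq0// gt_eqF.
  rewrite ler_distl ler_pdivlMr ?exprn_gt0// ler_pdivrMr ?exprn_gt0//.
  by rewrite mulrC x1 mulrC x2.
move: pp; rewrite mulrC => pp; have [h|h] := leP p.[T ^+ (2 * k).+1 * (l k - e)] 0.
  by apply: Num.poly_ivt => //; rewrite h/=; nra.
have [|x xi] := @Num.poly_ivt _ (- p) _ _ le12; last by rewrite rootN; exists x.
by rewrite !hornerN !oppr_le0 oppr_ge0 (ltW h)/=; nra.
Qed.

(** The roots found at the [n] scales [T ^+ (2 * k).+1] are pairwise separated for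
    small [T], hence they are the whole spectrum, in decreasing order. *)
Lemma eigvals_near (e : R) : 0 < e ->
  \forall T \near 0^'+, exists2 mu : nat -> R, forall k, `|mu k - l k| <= e &
    [/\ graded_at T, eigvals (G T) = mkseq (fun i => T ^+ (2 * i).+1 * mu i) n,
        forall k, root (char_poly (G T)) (T ^+ (2 * k).+1 * mu k) &
        forall i j : 'I_n, (i < j)%N ->
          T ^+ (2 * j).+1 * mu j < T ^+ (2 * i).+1 * mu i].
Proof.
move=> e0.
(* the tolerance must also stay below each [l k], to keep the roots positive *)
have [d [d0 de dl]] : exists d : R, [/\ 0 < d, d <= e & forall k, d < l k].
  have : \forall d \near (0 : R)^'+, [/\ 0 < d, d <= e & forall k, d < l k].
    have H1 := @nbhs_right_gt R 0; have H2 := nbhs_right_le e0.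
    have H3 : \forall d \near (0 : R)^'+, forall k, d < l k.
      by apply: filter_forall => k; exact: nbhs_right_lt.
    by apply: filterS3 H1 H2 H3.
  by move=> /filter_ex.
have near1 : \forall T \near 0^'+, forall k, exists2 m, `|m - l k| <= d &
    root (char_poly (G T)) (T ^+ (2 * k).+1 * m).
  by apply: filter_forall => k; exact: eigenvalue_near.
(* this makes the root of index [j] smaller than any root of index [i < j] *)
have near2 : \forall T \near 0^'+, T < 1 /\
    forall i j : 'I_n, T * (l j + d) < l i - d.
  apply: filterS2 (nbhs_right_lt (@ltr01 R)) (_ : \forall T \near 0^'+,
    forall i j : 'I_n, T * (l j + d) < l i - d) => // .
  apply: filter_forall => i; apply: filter_forall => j.
  have lj : 0 < l j + d by rewrite addr_gt0.
  have li : 0 < (l i - d) / (l j + d) by rewrite divr_gt0 ?subr_gt0.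
  by apply: filterS (nbhs_right_lt li) => T; rewrite ltr_pdivlMr.
apply: filterS3 gradedT near1 near2 => T gT H [T1 Tl].
have T0 : 0 < T by case: gT.
have /choice[f Hf] : forall k, exists m, `|m - l k| <= d /\
    root (char_poly (G T)) (T ^+ (2 * k).+1 * m).
  by move=> k; have [m ? ?] := H k; exists m.
pose mu i := if insub i is Some k then f k else 0.
have muE k : mu k = f k by rewrite /mu valK.
have mu_lt (i j : 'I_n) : (i < j)%N ->
    T ^+ (2 * j).+1 * mu j < T ^+ (2 * i).+1 * mu i.
  move=> ij; rewrite !muE.
  have [+ _] := Hf i; rewrite ler_distl => /andP[fi _].
  have [+ _] := Hf j; rewrite ler_distl => /andP[_ fj].
  have Ti : 0 < T ^+ (2 * i).+1 by rewrite exprn_gt0.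
  apply: (@le_lt_trans _ _ (T ^+ (2 * i).+1 * (T * (l j + d)))); last first.
    by rewrite ltr_pM2l//; exact: lt_le_trans (Tl i j) fi.
  rewrite mulrA -exprSr; apply: (@le_trans _ _ (T ^+ (2 * j).+1 * (l j + d))).
    by rewrite ler_pM2l// exprn_gt0.
  rewrite ler_pM2r ?addr_gt0//; apply: ler_wiXn2l; [exact: ltW|exact: ltW|lia].
exists mu => [k|]; first by rewrite muE; have [h _] := Hf k; exact: le_trans h de.
split => // [|k]; last by rewrite muE; have [] := Hf k.
apply: eigvals_distinct_roots; last 2 first.
- by rewrite size_mkseq.
- apply/allP => x /mapP[i]; rewrite mem_iota/= add0n => lt_in ->.
  by rewrite (muE (Ordinal lt_in)); have [] := Hf (Ordinal lt_in).
apply: (@homo_sorted_in _ _ [pred i | (i < n)%N] _ ltn); last exact: iota_ltn_sorted.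
- move=> i j lt_in lt_jn ij; exact: (mu_lt (Ordinal lt_in) (Ordinal lt_jn)).
- by apply/allP => i; rewrite mem_iota.
Qed.

Let mu k T := T ^- (2 * k).+1 * nth 0 (eigvals (G T)) k.

Lemma spectrum_near (e : R) : 0 < e -> \forall T \near 0^'+,
  [/\ graded_at T,
      forall k, nth 0 (eigvals (G T)) k = T ^+ (2 * k).+1 * mu k T,
      forall k, `|mu k T - l k| <= e,
      forall k, \det (pencil k (mu k T) T) = 0 &
      forall i j : 'I_n, nth 0 (eigvals (G T)) i = nth 0 (eigvals (G T)) j -> i = j].
Proof.
move=> /eigvals_near; apply: filterS => T [m ml [gT E rt lt_m]].
have T0 : 0 < T by case: gT.
have nE k : nth 0 (eigvals (G T)) k = T ^+ (2 * k).+1 * m k by rewrite E nth_mkseq.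
have muE k : mu k T = m k by rewrite /mu nE mulKf// expf_neq0// gt_eqF.
split => // [k|k|k|i j].
- by rewrite muE nE.
- by rewrite muE.
- by apply/eqP; rewrite -root_pencil// muE.
- rewrite !nE => eij; apply/val_inj.
  by case: (ltngtP i j) => // h; have := lt_m _ _ h; rewrite eij ltxx.
Qed.

Lemma cvg_scaled_eigval k : mu k T @[T --> 0^'+] --> l k.
Proof.
apply/cvgrPdist_le => e e0; apply: filterS (spectrum_near e e0) => T [_ _ H _ _].
by rewrite distrC.
Qed.

Let P k T := pencil k (mu k T) T.

(** When the pencil is singular the columns of its adjugate lie in its kernel.
    Being polynomial in the entries, the [k]-th one has a limit, and it is
    normalized here to have [k]-th entry 1. *)
Definition pencil_ker k T : 'cV[R]_n := (\adj (P k T) k k)^-1 *: col k (\adj (P k T)).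

(** The limit pencil is diagonal and its only zero diagonal entry is the [k]-th. *)
Lemma adj_pencil0 k i : (\adj (pencil0 k (l k)) i k == 0) = (i != k).
Proof.
set p := pencil0 k (l k).
have dp j : p j j = if (j < k)%N then l j else if j == k then l k - l k else - l k.
  by rewrite !mxE eqxx mulr1n.
have dp0 : \det p = 0.
  by rewrite det_diag (bigD1 k)//= mxE ltnn eqxx subrr mul0r.
have pjj j : j != k -> p j j != 0.
  move=> jk; rewrite dp (negbTE jk).
  by case: ifP => _; rewrite ?oppr_eq0 gt_eqF.
case: (eqVneq i k) => [->|ik] /=; last first.
  have := mul_mx_adj p; rewrite dp0 => /matrixP/(_ i k).
  rewrite mxE (bigD1 i)//= big1 ?addr0 => [|j ji]; last first.
    by rewrite [p i j]mxE eq_sym (negbTE ji) mulr0n mul0r.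
  by rewrite [RHS]mxE mul0rn => /eqP; rewrite mulf_eq0 (negbTE (pjj _ ik)).
apply/negbTE; rewrite mxE /cofactor mulf_neq0 ?signr_eq0//.
have -> : row' k (col' k p) = diag_mx (\row_j p (lift k j) (lift k j)).
  apply/matrixP => i' j'; rewrite !mxE (inj_eq lift_inj).
  by case: eqVneq => [->|_]; rewrite ?eqxx ?mulr1n ?mulr0n.
rewrite det_diag; apply/prodf_neq0 => j _; rewrite mxE; apply: pjj.
by rewrite eq_sym neq_lift.
Qed.

Lemma cvg_adj_pencil k i :
  \adj (P k T) i k @[T --> 0^'+] --> \adj (pencil0 k (l k)) i k.
Proof.
exact: (cvg_mx_entry _ _ _ _ (cvg_adj _ _ _ (cvg_pencil k (mu k) (l k) (cvg_scaled_eigval k)))).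
Qed.

Lemma cvg_pencil_ker k i : pencil_ker k T i 0 @[T --> 0^'+] --> ((i == k)%:R : R).
Proof.
have c0 : \adj (pencil0 k (l k)) k k != 0 by rewrite adj_pencil0 eqxx.
have -> : (i == k)%:R = (\adj (pencil0 k (l k)) k k)^-1 * \adj (pencil0 k (l k)) i k.
  case: (eqVneq i k) => [->|ik]; first by rewrite mulVf.
  by have := adj_pencil0 k i; rewrite ik => /eqP->; rewrite mulr0.
have E T : pencil_ker k T i 0 = (\adj (P k T) k k)^-1 * \adj (P k T) i k.
  by rewrite mxE [X in _ * X]mxE.
under eq_fun do rewrite E.
apply: cvgM; first exact: cvgV (cvg_adj_pencil k k).
exact: cvg_adj_pencil.
Qed.

Lemma pencil_ker_near k : \forall T \near 0^'+,
  pencil_ker k T k 0 = 1 /\ P k T *m pencil_ker k T = 0.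
Proof.
have c0 : \adj (pencil0 k (l k)) k k != 0 by rewrite adj_pencil0 eqxx.
have H := cvgr_neq0 _ (cvg_adj_pencil k k) c0.
apply: filterS2 (spectrum_near 1 ltr01) (H _) => T [gT _ _ d0 _] a0.
split; first by rewrite mxE [X in _ * X]mxE mulVf.
rewrite -scalemxAr colE mulmxA mul_mx_adj d0.
by rewrite mul_scalar_mx scale0r scaler0.
Qed.

Variables (H1 S1 : 'M[R]_n).
Hypothesis slopeH : T^-1 *: (Hh T - diag_mx (\row_(i < n) l i)) @[T --> 0^'+] --> H1.
Hypothesis slopeS : T^-1 *: (S T - 1%:M) @[T --> 0^'+] --> S1.
Hypothesis S1_diag : forall k, S1 k k = 0.

Let b k (i j : 'I_n) := 0 ^+ ((i - k) + (j - k)) * H1 i j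
               - l k * 0 ^+ ((k - i) + (k - j)) * S1 i j.

Lemma slope_pencil k (i j : 'I_n) : i != j ->
  T^-1 * P k T i j @[T --> 0^'+] --> b k i j.
Proof.
move=> ij; move/cvg_mxP: slopeH => /(_ i j) cH; move/cvg_mxP: slopeS => /(_ i j) cS.
under eq_fun do rewrite mxE mulrBr mulrCA [_^-1 * (_ * _ * _)]mulrCA.
have EH T : T^-1 * Hh T i j = (T^-1 *: (Hh T - diag_mx (\row_(i < n) l i))) i j.
  by rewrite !mxE (negbTE ij) mulr0n subr0.
have ES T : T^-1 * S T i j = (T^-1 *: (S T - 1%:M)) i j.
  by rewrite !mxE (negbTE ij) mulr0n subr0.
under eq_fun do rewrite EH ES.
apply: cvgB; first by apply: cvgM => //; exact: cvg_at_right_expr.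
apply: cvgM => //; apply: cvgM; first exact: cvg_scaled_eigval.
exact: cvg_at_right_expr.
Qed.

(** Row [i] of the equation of the kernel, solved for its diagonal term. *)
Lemma slope_pencil_row k i :
  T^-1 * (P k T i i * pencil_ker k T i 0) @[T --> 0^'+] -->
  - (if i == k then 0 else b k i k).
Proof.
apply: (cvg_near_eq _ _
  (fun T => - \sum_(j < n | j != i) T^-1 * P k T i j * pencil_ker k T j 0)).
  apply: filterS (pencil_ker_near k) => T [_ /matrixP/(_ i 0)].
  rewrite mxE (bigD1 i)//= [RHS]mxE => /eqP; rewrite addr_eq0 => /eqP ->.
  by rewrite mulrN mulr_sumr; congr (- _); apply: eq_bigr => j _; rewrite mulrA.
apply: cvgN.
have -> : (if i == k then 0 else b k i k) =
    \sum_(j < n | j != i) b k i j * ((j == k)%:R : R).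
  case: (eqVneq i k) => [->|ik].
    by rewrite big1// => j /negbTE->; rewrite mulr0.
  rewrite (bigD1 k) 1?eq_sym//= eqxx mulr1 big1 ?addr0// => j /andP[_ /negbTE->].
  by rewrite mulr0.
apply: cvg_sum => j ji; apply: cvgM; last exact: cvg_pencil_ker.
by apply: slope_pencil; rewrite eq_sym.
Qed.

(** The off-diagonal terms of row [k] are products of a pencil entry of order [T]
    with a kernel entry tending to 0. They do not contribute at first order, so
    [mu k T] follows the quotient of the [k]-th diagonal entries of [Hh T] and
    [S T]. *)
Lemma slope_scaled_eigval k : T^-1 * (mu k T - l k) @[T --> 0^'+] --> H1 k k.
Proof.
move/cvg_mxP: slopeH => /(_ k k) cH; move/cvg_mxP: slopeS => /(_ k k) cS.
apply: (cvg_near_eq _ _ (fun T =>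
    (T^-1 *: (Hh T - diag_mx (\row_(i < n) l i))) k k
    - T^-1 * (P k T k k * pencil_ker k T k 0) - mu k T * (T^-1 *: (S T - 1%:M)) k k)).
  apply: filterS (pencil_ker_near k) => T [-> _].
  by rewrite !mxE subnn addn0 expr0 eqxx !mulr1n; ring.
rewrite -[X in _ --> X](_ : H1 k k - 0 - l k * S1 k k = _); last first.
  by rewrite S1_diag mulr0 !subr0.
apply: cvgB; last by apply: cvgM => //; exact: cvg_scaled_eigval.
apply: cvgB => //; have := slope_pencil_row k k.
by rewrite eqxx oppr0.
Qed.

Lemma slope_pencil_ker k i : i != k ->
  T^-1 * pencil_ker k T i 0 @[T --> 0^'+] --> - (b k i k / pencil0 k (l k) i i).
Proof.
move=> ik.
have p0 : pencil0 k (l k) i i != 0.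
  rewrite !mxE eqxx mulr1n (negbTE ik).
  by case: ifP => _; rewrite ?oppr_eq0 gt_eqF.
have cP : P k T i i @[T --> 0^'+] --> pencil0 k (l k) i i.
  exact: (cvg_mx_entry _ _ _ _ (cvg_pencil k (mu k) (l k) (cvg_scaled_eigval k))).
apply: (cvg_near_eq _ _ (fun T => T^-1 * (P k T i i * pencil_ker k T i 0) / P k T i i)).
  have H := cvgr_neq0 _ cP p0; apply: filterS (H _) => T pT.
  by rewrite [P k T i i * _]mulrC mulrA mulfK.
rewrite -mulNr; apply: cvgM; last exact: cvgV cP.
by have := slope_pencil_row k i; rewrite (negbTE ik).
Qed.

(** Coordinates in the basis [Z T] of the eigenvector of index [k]. *)
Definition graded_vec k T : 'cV[R]_n := rescale k T *m pencil_ker k T.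

(** Entries of index [i < k] carry an extra factor [T ^+ (k - i)] and drop out at
    first order; for [i > k] row [i] of the kernel equation compares the metric
    term [- l k * S1 i k] with the diagonal limit [- l k]. *)
Lemma slope_graded_vec k :
  T^-1 *: (graded_vec k T - delta_mx k 0) @[T --> 0^'+] -->
  (\col_i (if (k < i)%N then - S1 i k else 0) : 'cV[R]_n).
Proof.
apply/cvg_mxP => i j; rewrite ord1 mxE.
have E T : (T^-1 *: (graded_vec k T - delta_mx k 0)) i 0 =
    T^-1 * (T ^+ (k - i) * pencil_ker k T i 0 - (i == k)%:R).
  by rewrite /graded_vec mul_diag_mx !mxE eqxx andbT.
under eq_fun do rewrite E.
case: (ltngtP k i) => ki.
- have ik : i != k by apply/eqP => e; rewrite e ltnn in ki.
  under eq_fun do rewrite (eqP (ltnW ki : _ - _ == 0)%N) mul1r (negbTE ik) subr0.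
  have := slope_pencil_ker k i ik.
  congr (_ --> _); rewrite /b !mxE eqxx mulr1n (negbTE ik) ltnNge (ltnW ki)/=.
  rewrite subnn addn0 expr0n subn_eq0 leqNgt ki/= mul0r sub0r.
  rewrite (eqP (ltnW ki : _ - _ == 0)%N) addn0 expr0 mulr1 invrN mulrN mulNr opprK.
  by rewrite mulrAC mulfV ?mul1r// gt_eqF.
- have ik : i != k by apply/eqP => e; rewrite e ltnn in ki.
  apply: (cvg_near_eq _ _ (fun T => T ^+ (k - i).-1 * pencil_ker k T i 0)).
    apply: filterS (nbhs_right_neq 0) => T T0; rewrite (negbTE ik) subr0 mulrA.
    by rewrite -{1}(prednK (_ : 0 < k - i)%N) ?subn_gt0// exprS mulKf.
  rewrite -[X in _ --> X](mulr0 (0 ^+ (k - i).-1)); apply: cvgM; first exact: cvg_at_right_expr.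
  by have := cvg_pencil_ker k i; rewrite (negbTE ik).
- have -> : i = k by apply/val_inj.
  apply: (cvg_near_eq _ _ (fun=> 0)); last exact: cvg_cst.
  apply: filterS (pencil_ker_near k) => T [-> _].
  by rewrite subnn mul1r eqxx subrr mulr0.
Qed.

Lemma graded_eigenvector k : \forall T \near 0^'+,
  G T *m (Z T *m graded_vec k T) =
  nth 0 (eigvals (G T)) k *: (Z T *m graded_vec k T).
Proof.
apply: filterS2 (pencil_ker_near k) (spectrum_near 1 ltr01) => T [_ Pw] [gT E _ _ _].
by rewrite E; exact: pencil_ker_eigenvector.
Qed.


End Graded.

(** * The matrix exponential and its Taylor estimate *)

Section MatrixExp.
Context {R : realType} {n : nat}.
Implicit Types (A : 'M[R]_n) (x y : 'cV[R]_n) (t : R) (m N : nat).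

Lemma exprZmx t A m : (t *: A) ^+ m = t ^+ m *: A ^+ m.
Proof.
elim: m => [|m IH]; first by rewrite !expr0 scale1r.
by rewrite !exprS IH -[LHS]/(_ *m _) -scalemxAl -scalemxAr scalerA.
Qed.

Let rho A : R := \sum_i \sum_j `|A i j|.

Lemma norm_exprmx A m i j : `|(A ^+ m) i j| <= rho A ^+ m.
Proof.
elim: m i j => [|m IH] i j.
  by rewrite expr0 mxE; case: eqVneq => _; rewrite ?normr1 ?normr0 ?ler01.
rewrite exprS mxE (le_trans (ler_norm_sum _ _ _))// exprS.
apply: (@le_trans _ _ (\sum_k `|A i k| * rho A ^+ m)).
  by apply: ler_sum => k _; rewrite normrM ler_wpM2l.
rewrite -mulr_suml ler_wpM2r//.
  by rewrite exprn_ge0// sumr_ge0// => k _; rewrite sumr_ge0.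
rewrite /rho [leRHS](bigD1 i)//= lerDl sumr_ge0// => k _; exact: sumr_ge0.
Qed.

Lemma sum_norm_entries_ge0 A : 0 <= rho A.
Proof. by rewrite sumr_ge0// => k _; rewrite sumr_ge0. Qed.

(** Entrywise, the series is dominated by the exponential series at [rho (t *: A)]. *)
Lemma cvg_expmx A t :
  series (fun m => (m`!%:R)^-1 *: (t *: A) ^+ m) @ \oo --> expmx (t *: A).
Proof.
suff : forall i j, cvgn (series (fun m => (m`!%:R)^-1 * ((t *: A) ^+ m) i j)).
  move=> H; apply: (@cvgP _ _ (\matrix_(i, j)
    limn (series (fun m => (m`!%:R)^-1 * ((t *: A) ^+ m) i j)))).
  apply/cvg_mxP => i j; rewrite mxE.
  have E N : (series (fun m => (m`!%:R)^-1 *: (t *: A) ^+ m) N) i j =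
      series (fun m => (m`!%:R)^-1 * ((t *: A) ^+ m) i j) N.
    by rewrite /series/= summxE; apply: eq_bigr => k _; rewrite mxE.
  by under eq_fun do rewrite E; exact: H.
move=> i j; apply: normed_cvg.
apply: (@series_le_cvg _ _ (exp_coeff (rho (t *: A)))) => [m|m|m|].
- exact: normr_ge0.
- by rewrite exp_coeff_ge0// sum_norm_entries_ge0.
  rewrite /exp_coeff/= normrM normfV (ger0_norm (ler0n _ _)) mulrC.
  by rewrite ler_wpM2r ?invr_ge0// norm_exprmx.
- exact: is_cvg_series_exp_coeff.
Qed.

Lemma trmx_expr A m : (A ^+ m)^T = A^T ^+ m.
Proof.
elim: m => [|m IH]; first by rewrite !expr0 trmx1.
by rewrite exprS exprSr -[LHS]/(_ *m _)^T trmx_mul IH.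
Qed.

Lemma expmx_tr A t : (expmx (t *: A))^T = expmx (t *: A^T).
Proof.
have := cvg_trmx _ _ _ _ (cvg_expmx A t).
have E N : (series (fun m => (m`!%:R)^-1 *: (t *: A) ^+ m) N)^T =
    series (fun m => (m`!%:R)^-1 *: (t *: A^T) ^+ m) N.
  rewrite /series/= linear_sum/=; apply: eq_bigr => k _.
  by rewrite linearZ/= trmx_expr linearZ.
under eq_fun do rewrite E.
move=> H; rewrite -(cvg_lim (@norm_hausdorff _ _) (H _)).
by rewrite -(cvg_lim (@norm_hausdorff _ _) (cvg_expmx A^T t)).
Qed.

(** The entries of [e^(tA) y] and its coordinates in the Krylov basis are all of
    this form. *)
Definition flow A x y t : R := dotp x (expmx (t *: A) *m y).

Let coef A x y m : R := dotp x (A ^+ m *m y) / m`!%:R.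

Lemma cvg_flow A x y t :
  (\sum_(0 <= m < N) coef A x y m * t ^+ m) @[N --> \oo] --> flow A x y t.
Proof.
rewrite /flow dotpE.
have E N : \sum_(0 <= m < N) coef A x y m * t ^+ m =
    (x^T *m (series (fun m => (m`!%:R)^-1 *: (t *: A) ^+ m) N *m y)) 0 0.
  rewrite /series/= mulmx_suml mulmx_sumr summxE; apply: eq_bigr => m _.
  rewrite exprZmx -!scalemxAl -!scalemxAr !mxE -/(dotp _ _) /coef dotpE.
  by rewrite mxE -[LHS]mulrA mulrC mulrA.
under eq_fun do rewrite E.
apply: cvg_mx_entry; apply: cvg_mulmx; first exact: cvg_cst.
by apply: cvg_mulmx; [exact: cvg_expmx|exact: cvg_cst].
Qed.

Lemma measurable_flow A x y : measurable_fun setT (flow A x y).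
Proof.
apply: (@measurable_fun_cvg _ _ _ _
  (fun N t => \sum_(0 <= m < N) coef A x y m * t ^+ m)) => [N|t _].
  apply: measurable_sum => m; apply: measurable_funM => //.
exact: cvg_flow.
Qed.

(** For [t <= 1] the tail of the series from [N] on is at most [t ^+ N] times the
    dominating exponential series at [t = 1], which is independent of [t]. *)
Lemma flow_taylor A x y N : exists C : R, forall t, 0 <= t <= 1 ->
  `|flow A x y t - \sum_(0 <= m < N) coef A x y m * t ^+ m| <= C * t ^+ N.
Proof.
pose K := \sum_i \sum_j `|x i 0| * `|y j 0|.
have K0 : 0 <= K by rewrite sumr_ge0// => i _; rewrite sumr_ge0// => j _; rewrite mulr_ge0.
have coefK m : `|coef A x y m| <= K * exp_coeff (rho A) m.
  rewrite /coef normrM normfV (ger0_norm (ler0n _ _)) mulrA ler_wpM2r ?invr_ge0//.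
  rewrite /K mulr_suml (le_trans (ler_norm_sum _ _ _))//; apply: ler_sum => i _.
  rewrite mulr_suml normrM mxE.
  apply: (le_trans (ler_wpM2l (normr_ge0 _) (ler_norm_sum _ _ _))).
  rewrite mulr_sumr; apply: ler_sum => j _.
  by rewrite normrM -mulrA ler_wpM2l// mulrC ler_wpM2l// norm_exprmx.
exists (K * expR (rho A)) => t /andP[t0 t1].
have tN0 : 0 <= t ^+ N by rewrite exprn_ge0.
have cf := cvg_flow A x y t.
have cfN : `|\sum_(0 <= m < M) coef A x y m * t ^+ m
             - \sum_(0 <= m < N) coef A x y m * t ^+ m| @[M --> \oo] -->
    `|flow A x y t - \sum_(0 <= m < N) coef A x y m * t ^+ m|.
  by apply: cvg_norm; apply: cvgB => //; exact: cvg_cst.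
rewrite -(cvg_lim _ cfN)//; apply: limr_le; first by apply: cvgP cfN.
exists N => // M /= NM.
have -> : \sum_(0 <= m < M) coef A x y m * t ^+ m - \sum_(0 <= m < N) coef A x y m * t ^+ m
    = \sum_(N <= m < M) coef A x y m * t ^+ m.
  by rewrite (big_cat_nat _ NM)//= addrAC subrr add0r.
rewrite (le_trans (ler_norm_sum _ _ _))//.
apply: (@le_trans _ _ (\sum_(N <= m < M) (K * exp_coeff (rho A) m) * t ^+ N)).
  apply: ler_sum_nat => m /andP[Nm _]; rewrite normrM ler_pM//.
  by rewrite ger0_norm ?exprn_ge0// ler_wiXn2l.
rewrite -mulr_suml -mulr_sumr ler_wpM2r// ler_wpM2l//.
apply: (@le_trans _ _ (series (exp_coeff (rho A)) M)).
  rewrite /series/= [leRHS](big_cat_nat _ NM)//= lerDr sumr_ge0// => m _.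
  by rewrite exp_coeff_ge0 ?sum_norm_entries_ge0.
apply: nondecreasing_cvgn_le; last exact: is_cvg_series_exp_coeff.
apply: nondecreasing_series => m _ _; exact: exp_coeff_ge0 (sum_norm_entries_ge0 A).
Qed.

End MatrixExp.

(** * Integrals over short intervals *)

Section Integrals.
Context {R : realType}.
Implicit Types (f g : R -> R) (T t c : R).
Local Notation mu := (@lebesgue_measure R).

(** A class of integrable functions on [[0, T]] that is stable under products. *)
Definition bounded_meas T f :=
  measurable_fun setT f /\ exists C, forall t, 0 <= t <= T -> `|f t| <= C.

Lemma bounded_meas_integrable T f : bounded_meas T f ->
  mu.-integrable `[0, T] (EFin \o f).
Proof.
move=> [mf [C fC]]; apply: measurable_bounded_integrable => //.
- by rewrite /= lebesgue_measure_itv/=; case: ifP => _; rewrite ?ltry// -EFinB ltry.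
- exact: measurable_funS mf.
- exists C; split; first exact: num_real.
  move=> x Cx t /=; rewrite in_itv/= => tT.
  exact: le_trans (fC t tT) (ltW Cx).
Qed.

Lemma bounded_measD T f g : bounded_meas T f -> bounded_meas T g ->
  bounded_meas T (fun t => f t + g t).
Proof.
move=> [mf [C fC]] [mg [D gD]]; split; first exact: measurable_funD.
by exists (C + D) => t tT; rewrite (le_trans (ler_normD _ _))// lerD ?fC ?gD.
Qed.

Lemma bounded_measM T f g : bounded_meas T f -> bounded_meas T g ->
  bounded_meas T (fun t => f t * g t).
Proof.
move=> [mf [C fC]] [mg [D gD]]; split; first exact: measurable_funM.
by exists (C * D) => t tT; rewrite normrM ler_pM// ?fC ?gD.
Qed.

Lemma bounded_meas_cst T c : bounded_meas T (fun=> c).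
Proof. by split; [exact: measurable_cst|exists `|c|]. Qed.

Lemma bounded_meas_exprn T m : bounded_meas T (fun t => t ^+ m).
Proof.
split; first exact: exprn_measurable.
exists (T ^+ m) => t /andP[t0 tT]; rewrite ger0_norm ?exprn_ge0//.
by rewrite lerXn2r// ?nnegrE// (le_trans t0).
Qed.

Lemma bounded_meas_sum T (I : Type) (s : seq I) (h : I -> R -> R) :
  (forall i, bounded_meas T (h i)) -> bounded_meas T (fun t => \sum_(i <- s) h i t).
Proof.
move=> H; elim: s => [|i s IH].
  by under eq_fun do rewrite big_nil; exact: bounded_meas_cst.
by under eq_fun do rewrite big_cons; exact: bounded_measD.
Qed.

Lemma Rintegral_sum T (I : Type) (s : seq I) (h : I -> R -> R) :
  (forall i, bounded_meas T (h i)) ->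
  \int[mu]_(t in `[0, T]) (\sum_(i <- s) h i t) =
  \sum_(i <- s) \int[mu]_(t in `[0, T]) h i t.
Proof.
move=> H; elim: s => [|i s IH].
  rewrite big_nil; under eq_Rintegral do rewrite big_nil.
  by rewrite Rintegral_cst// mul0r.
rewrite big_cons -IH; under eq_Rintegral do rewrite big_cons.
by rewrite RintegralD//; apply: bounded_meas_integrable => //; exact: bounded_meas_sum.
Qed.

Lemma Rintegral_exprn T m : 0 < T ->
  \int[mu]_(t in `[0, T]) t ^+ m = T ^+ m.+1 / m.+1%:R.
Proof.
move=> T0; rewrite /Rintegral.
have m0 : m.+1%:R != 0 :> R by rewrite pnatr_eq0.
rewrite (@continuous_FTC2 _ _ (fun t => t ^+ m.+1 / m.+1%:R) 0 T)//=.
- by rewrite expr0n/= mul0r subr0.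
- by apply: continuous_in_subspaceT => x _; exact: exprn_continuous.
- have cF : continuous (fun t : R => t ^+ m.+1 / m.+1%:R).
    by move=> x; apply: cvgM; [exact: exprn_continuous|exact: cvg_cst].
  split.
  + by move=> x _; apply: derivableM; [exact: exprn_derivable|exact: derivable_cst].
  + by apply: cvg_at_right_filter; exact: cF.
  + by apply: cvg_at_left_filter; exact: cF.
- move=> x _; rewrite derive1Mr//; last exact: exprn_derivable.
  by rewrite exp_derive1 /= mulrAC divff ?mul1r.
Qed.

Lemma norm_Rintegral_le T (C : R) f : 0 < T -> bounded_meas T f ->
  (forall t, 0 <= t <= T -> `|f t| <= C) ->
  `|\int[mu]_(t in `[0, T]) f t| <= C * T.
Proof.
move=> T0 bf fC; have fi := bounded_meas_integrable _ _ bf.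
apply: (le_trans (le_normr_Rintegral _ fi)) => //.
have -> : C * T = \int[mu]_(t in `[0, T]) C.
  by rewrite Rintegral_cst//= lebesgue_measure_itv/= lte_fin T0 -EFinB/= subr0.
apply: le_Rintegral => //.
- exact: integrable_norm.
- exact: (bounded_meas_integrable _ _ (bounded_meas_cst T C)).
Qed.

Definition two_terms i c d t : R := t ^+ i * (c + d * t).

(** The main terms are integrated exactly; the rest is of order [t ^+ (i + j).+2],
    and the length [T] of the interval gives one more power. *)
Lemma Rintegral_two_terms f g i j c d c' d' :
  bounded_meas 1 f -> bounded_meas 1 g ->
  (exists C, forall t, 0 <= t <= 1 -> `|f t - two_terms i c d t| <= C * t ^+ i.+2) ->
  (exists C, forall t, 0 <= t <= 1 -> `|g t - two_terms j c' d' t| <= C * t ^+ j.+2) ->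
  exists C, forall T, 0 < T <= 1 ->
  `|\int[mu]_(t in `[0, T]) (f t * g t) -
    T ^+ (i + j).+1 * (c * c' / (i + j).+1%:R + T * ((c * d' + d * c') / (i + j).+2%:R))|
  <= C * T ^+ (i + j).+3.
Proof.
move=> bf bg [C fC] [C' gC].
(* the bounds of the four products left when [f * g] is expanded *)
pose D := C * (`|c'| + `|d'| + C') + C' * (`|c| + `|d|) + `|d * d'|.
have C0 : 0 <= C.
  by have := fC 1; rewrite expr1n mulr1 ler01 lexx => /(_ isT); apply: le_trans.
have C'0 : 0 <= C'.
  by have := gC 1; rewrite expr1n mulr1 ler01 lexx => /(_ isT); apply: le_trans.
exists D => T /andP[T0 T1].
pose p t := c * c' * t ^+ (i + j) + (c * d' + d * c') * t ^+ (i + j).+1.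
have bsub h : bounded_meas 1 h -> bounded_meas T h.
  move=> [mh [B hB]]; split=> //; exists B => t /andP[t0 tT]; apply: hB.
  by rewrite t0 (le_trans tT).
have bp : bounded_meas T p.
  by apply: bounded_measD; apply: bounded_measM;
    [exact: bounded_meas_cst|exact: bounded_meas_exprn
    |exact: bounded_meas_cst|exact: bounded_meas_exprn].
have bfg : bounded_meas T (fun t => f t * g t) by apply: bounded_measM; exact: bsub.
have Ip : \int[mu]_(t in `[0, T]) p t =
    T ^+ (i + j).+1 * (c * c' / (i + j).+1%:R + T * ((c * d' + d * c') / (i + j).+2%:R)).
  rewrite RintegralD//; last 2 first.
  - apply/bounded_meas_integrable/bounded_measM;
      [exact: bounded_meas_cst|exact: bounded_meas_exprn].
  - apply/bounded_meas_integrable/bounded_measM;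
      [exact: bounded_meas_cst|exact: bounded_meas_exprn].
  rewrite !RintegralZl//; try exact: bounded_meas_integrable _ _ (bounded_meas_exprn _ _).
  rewrite !Rintegral_exprn//.
  have h1 : (i + j).+1%:R != 0 :> R by rewrite pnatr_eq0.
  have h2 : (i + j).+2%:R != 0 :> R by rewrite pnatr_eq0.
  rewrite (exprS T (i + j).+1); move: (T ^+ (i + j).+1) => X.
  move: (i + j).+1%:R (i + j).+2%:R h1 h2 => u v u0 v0.
  by field; rewrite u0 v0.
rewrite -Ip -RintegralB//; try exact: bounded_meas_integrable.
rewrite (exprSr T (i + j).+2) mulrA.
apply: norm_Rintegral_le => //.
  have bpN : bounded_meas T (fun t => -1 * p t).
    by apply: bounded_measM => //; exact: bounded_meas_cst.
  have := bounded_measD _ _ _ bfg bpN.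
  by under eq_fun do rewrite mulN1r.
move=> t /andP[t0 tT]; have t1 : 0 <= t <= 1 by rewrite t0 (le_trans tT).
have {}fC := fC t t1; have {}gC := gC t t1.
set e := f t - _ in fC; set e' := g t - _ in gC.
have -> : f t * g t - p t =
    e * two_terms j c' d' t + e * e' + e' * two_terms i c d t + d * d' * t ^+ (i + j).+2.
  rewrite /e /e' /p /two_terms !exprS exprD; ring.
have le2 k x y : `|two_terms k x y t| <= t ^+ k * (`|x| + `|y|).
  rewrite normrM ger0_norm ?exprn_ge0// ler_wpM2l ?exprn_ge0//.
  rewrite (le_trans (ler_normD _ _))// lerD2l normrM ler_piMr//.
  by rewrite ger0_norm//; case/andP: t1.
have tpow k : 0 <= t ^+ k by rewrite exprn_ge0.
apply: (@le_trans _ _ (D * t ^+ (i + j).+2)); last first.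
  rewrite ler_wpM2l// ?lerXn2r ?nnegrE// ?(ltW T0)//.
  by rewrite /D !addr_ge0// mulr_ge0// ?addr_ge0.
have E1 : `|e * two_terms j c' d' t| <= C * (`|c'| + `|d'|) * t ^+ (i + j).+2.
  rewrite normrM; apply: (le_trans (ler_pM _ _ fC (le2 _ _ _))) => //.
  by rewrite -!addSn exprD; nra.
have E2 : `|e * e'| <= C * C' * t ^+ (i + j).+2.
  rewrite normrM; apply: (le_trans (ler_pM _ _ fC gC)) => //.
  have -> : C * t ^+ i.+2 * (C' * t ^+ j.+2) = C * C' * t ^+ (i + j).+2 * t ^+ 2.
    by rewrite !exprS exprD; ring.
  apply: ler_piMr; first by rewrite (mulr_ge0 (mulr_ge0 C0 C'0) (tpow _)).
  by rewrite exprn_ile1//; case/andP: t1.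
have E3 : `|e' * two_terms i c d t| <= C' * (`|c| + `|d|) * t ^+ (i + j).+2.
  rewrite normrM; apply: (le_trans (ler_pM _ _ gC (le2 _ _ _))) => //.
  by rewrite addnC -!addSn exprD; nra.
have E4 : `|d * d' * t ^+ (i + j).+2| <= `|d * d'| * t ^+ (i + j).+2.
  by rewrite normrM [`|t ^+ _|]ger0_norm.
have -> : D * t ^+ (i + j).+2 = C * (`|c'| + `|d'|) * t ^+ (i + j).+2
    + C * C' * t ^+ (i + j).+2 + C' * (`|c| + `|d|) * t ^+ (i + j).+2
    + `|d * d'| * t ^+ (i + j).+2.
  by rewrite /D; ring.
by do 3! (apply: (le_trans (ler_normD _ _)); apply: lerD => //).
Qed.

End Integrals.

(** * Expansion of the Gramian in the Krylov basis *)

Section GramianExpansion.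
Context {R : realType} {n : nat}.
Implicit Types (A : 'M[R]_n) (x y b : 'cV[R]_n) (T t : R).

Lemma bounded_flow A x y : bounded_meas 1 (flow A x y).
Proof.
split; first exact: measurable_flow.
have [C HC] := flow_taylor A x y 0.
by exists C => t /HC; rewrite big_geq// subr0 expr0 mulr1.
Qed.

(** The integrand defining the Gramian is the rank-one matrix of the vector
    [e^(tA) b]. *)
Lemma dotp_gramian A b x y T : 0 < T <= 1 ->
  dotp x (gramian A b T *m y) =
  \int[lebesgue_measure]_(t in `[0, T]) (flow A x b t * flow A y b t).
Proof.
move=> /andP[T0 T1].
pose e (i : 'I_n) : 'cV[R]_n := delta_mx i 0.
have dotpe i z : dotp (e i) z = z i 0.
  rewrite /dotp (bigD1 i)//= mxE !eqxx mul1r big1 ?addr0// => j /negbTE ji.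
  by rewrite mxE ji mul0r.
have bf i : bounded_meas T (flow A (e i) b).
  have [mf [C fC]] := bounded_flow A (e i) b; split => //.
  by exists C => t /andP[t0 tT]; apply: fC; rewrite t0 (le_trans tT).
have flowE z t : flow A z b t = \sum_i z i 0 * flow A (e i) b t.
  by rewrite /flow {1}/dotp; apply: eq_bigr => i _; rewrite dotpe.
have gE i j : gramian A b T i j =
    \int[lebesgue_measure]_(t in `[0, T]) (flow A (e i) b t * flow A (e j) b t).
  rewrite mxE; apply: eq_Rintegral => t _.
  rewrite -expmx_tr -[_ *m b^T *m _]mulmxA -trmx_mul mxE big_ord1.
  by rewrite /flow !dotpe [X in _ * X]mxE.
under eq_Rintegral do rewrite !flowE mulr_suml.
rewrite Rintegral_sum => [|i]; last first.
  apply: bounded_measM; first by apply: bounded_measM => //; exact: bounded_meas_cst.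
  by apply: bounded_meas_sum => j; apply: bounded_measM => //; exact: bounded_meas_cst.
apply: eq_bigr => i _; rewrite mxE mulr_sumr.
under eq_Rintegral do rewrite mulr_sumr.
rewrite Rintegral_sum => [|j]; last first.
  by apply: bounded_measM; apply: bounded_measM => //; exact: bounded_meas_cst.
apply: eq_bigr => j _; rewrite gE.
under [RHS]eq_Rintegral do rewrite mulrACA.
rewrite [RHS]RintegralZl//; last first.
  by apply: bounded_meas_integrable; exact: bounded_measM.
by rewrite -mulrA [_ * y j 0]mulrC.
Qed.

End GramianExpansion.

Section GramianKrylov.
Context {R : realType} {n : nat} (A : 'M[R]_n) (b : 'cV[R]_n).
Hypothesis Ab_kalman : kalman A b.
Implicit Types (i j k : 'I_n) (T t : R).

Let q (i : nat) := krylov_q A b i.+1.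
Let Q := krylov_mx A b.
Let g (i m : nat) := dotp (q i) (A ^+ m *m b).
(** First two Taylor coefficients, from degree [i] on, of [<q i, e^(tA) b>]. *)
Let c (i : nat) : R := g i i / i`!%:R.
Let d (i : nat) : R := g i i.+1 / i.+1`!%:R.

Lemma krylov_mx_conjE (M : 'M[R]_n) i j :
  (Q^T *m M *m Q) i j = dotp (q i) (M *m q j).
Proof.
rewrite -krylov_mx_tr_mulE -/Q -[q j](col_krylov_mx A b j) -/Q colE !mulmxA -colE.
by rewrite [RHS]mxE.
Qed.

(** The power series of [<q i, e^(tA) b>] starts at [t ^+ i], since [q i] is
    orthogonal to the Krylov vectors of lower index. *)
Lemma flow_two_terms i : exists C, forall t, 0 <= t <= 1 ->
  `|flow A (q i) b t - two_terms i (c i) (d i) t| <= C * t ^+ i.+2.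
Proof.
have [C HC] := flow_taylor A (q i) b i.+2; exists C => t /HC.
rewrite !big_nat_recr//= big_nat big1 ?add0r; last first.
  move=> m /andP[_ mi]; rewrite -/(g i m) /g krylov_coord_low// ?mul0r//.
rewrite -/(g i i) -/(g i i.+1) -/(c i) -/(d i).
have -> : c i * t ^+ i + d i * t ^+ i.+1 = two_terms i (c i) (d i) t.
  by rewrite /two_terms exprS; ring.
by [].
Qed.

(** The Gramian in the Krylov basis, with the powers of [T] taken out. *)
Definition gram_scaled T : 'M[R]_n :=
  \matrix_(i, j) (T ^- (i + j).+1 * (Q^T *m gramian A b T *m Q) i j).

Definition gram_lead : 'M[R]_n := \matrix_(i, j) (c i * c j / (i + j).+1%:R).

Definition gram_next : 'M[R]_n :=
  \matrix_(i, j) ((c i * d j + d i * c j) / (i + j).+2%:R).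

Lemma slope_gram_scaled :
  T^-1 *: (gram_scaled T - gram_lead) @[T --> 0^'+] --> gram_next.
Proof.
apply/cvg_mxP => i j.
have [C HC] := Rintegral_two_terms _ _ _ _ _ _ _ _ (bounded_flow A (q i) b)
  (bounded_flow A (q j) b) (flow_two_terms i) (flow_two_terms j).
apply/cvgrPdist_le => e e0.
have e1 : 0 < e / (`|C| + 1) by rewrite divr_gt0// ltr_wpDl.
apply: filterS3 (nbhs_right_gt 0) (nbhs_right_le (@ltr01 R)) (nbhs_right_le e1) => T T0 T1 Te.
have := HC T; rewrite T0 T1 -(dotp_gramian _ _ _ _ _) ?T0 ?T1// => /(_ isT) H.
have -> : (T^-1 *: (gram_scaled T - gram_lead)) i j =
    T^-1 * (T ^- (i + j).+1 * dotp (q i) (gramian A b T *m q j) - c i * c j / (i + j).+1%:R).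
  by rewrite -krylov_mx_conjE !mxE.
rewrite distrC mxE.
set p := dotp _ _ in H *; set u := c i * c j / _ in H *; set v := _ / (i + j).+2%:R in H *.
have T0' : T != 0 by rewrite gt_eqF.
have -> : T^-1 * (T ^- (i + j).+1 * p - u) - v =
    T ^- (i + j).+2 * (p - T ^+ (i + j).+1 * (u + T * v)).
  have X0 : T ^+ (i + j).+1 != 0 by rewrite expf_neq0.
  rewrite (exprS T (i + j).+1); move: (T ^+ (i + j).+1) X0 => X X0.
  by field; rewrite T0' X0.
rewrite normrM normfV (ger0_norm (exprn_ge0 _ (ltW T0))) mulrC ler_pdivrMr ?exprn_gt0//.
apply: le_trans H _; rewrite (exprS T (i + j).+2) mulrA.
apply: ler_wpM2r; first by rewrite exprn_ge0 ?ltW.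
have C1 : 0 < `|C| + 1 by rewrite ltr_wpDl.
apply: (@le_trans _ _ ((`|C| + 1) * T)); last by rewrite mulrC -ler_pdivlMr.
by rewrite ler_wpM2r ?(ltW T0)// (le_trans (ler_norm C))// lerDl.
Qed.

End GramianKrylov.

(** * Diagonalization of the leading term by Legendre polynomials *)

Lemma integ01_sum (R : numFieldType) n (p r : {poly R}) :
  (size p <= n)%N ->
  integ01 (p * r) = \sum_(i < n) p`_i * integ01 ('X^i * r).
Proof.
move=> sp; have {1}-> : p = \sum_(i < n) p`_i *: 'X^i.
  rewrite -poly_def; apply/polyP => i; rewrite coef_poly; case: ltnP => // ni.
  by rewrite nth_default// (leq_trans sp).
rewrite mulr_suml linear_sum/=; apply: eq_bigr => i _.
by rewrite integ01Zl.
Qed.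

Lemma integ01M (R : numFieldType) n (p r : {poly R}) :
  (size p <= n)%N -> (size r <= n)%N ->
  integ01 (p * r) = \sum_(i < n) \sum_(j < n) p`_i * r`_j / (i + j).+1%:R.
Proof.
move=> sp sr; rewrite (integ01_sum _ n)//; apply: eq_bigr => i _.
rewrite mulrC ['X^i * r]mulrC (integ01_sum _ n)// mulr_suml; apply: eq_bigr => j _.
by rewrite -exprD integ01Xn [(j + i)%N]addnC; ring.
Qed.

Lemma conj_mxE (R : comNzRingType) n (V M : 'M[R]_n) i j :
  (V^T *m M *m V) i j = \sum_k \sum_m V k i * M k m * V m j.
Proof.
rewrite mxE exchange_big; apply: eq_bigr => m _; rewrite mxE mulr_suml.
by apply: eq_bigr => k _; rewrite [X in X * _ * _]mxE.
Qed.

Section LegendreReduction.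
Context {R : realType} {n : nat} (A : 'M[R]_n) (b : 'cV[R]_n).
Hypotheses (Ab_kalman : kalman A b) (A_sym : A = A^T).
Implicit Types (i j k : 'I_n) (T t : R).

Let q (i : nat) := krylov_q A b i.+1.
Let g (i m : nat) := dotp (q i) (A ^+ m *m b).
Let J (i j : nat) := dotp (q i) (A *m q j).
Let c (i : nat) : R := g i i / i`!%:R.
Let d (i : nat) : R := g i i.+1 / i.+1`!%:R.

(** The Hilbert matrix is the Gram matrix of the monomials on [0, 1], so the
    Legendre coefficients diagonalize it; [gram_lead] is the Hilbert matrix
    scaled by the [c i], which accounts for the factor [c j / c i]. *)
Definition legendre_mx : 'M[R]_n :=
  \matrix_(i, j) (c j / c i * (legendre j : {poly R})`_i).
Let W := legendre_mx.

Definition ell_lead (k : nat) : R := c k ^+ 2 * legendre_sqnorm k.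
Let l := ell_lead.

Lemma gram_coef_gt0 i : 0 < c i.
Proof. by rewrite divr_gt0 ?ltr0n ?fact_gt0// krylov_coord_diag_gt0. Qed.
Let c_neq0 i : c i != 0. Proof. by rewrite gt_eqF ?gram_coef_gt0. Qed.

Lemma ell_lead_gt0 i : 0 < l i.
Proof.
rewrite mulr_gt0 ?exprn_gt0 ?gram_coef_gt0//.
by rewrite divr_gt0 ?exprn_gt0 ?ltr0n ?muln_gt0 ?fact_gt0.
Qed.

Lemma legendre_mx_low i j : (j < i)%N -> W i j = 0.
Proof. by move=> ji; rewrite mxE coef_legendre_gt ?mulr0. Qed.

Lemma legendre_mx_diag i : W i i = 1.
Proof. by rewrite mxE mulfV// mul1r coef_legendre_lead. Qed.

(** The ratio [c i.+1 / c i] is [J i.+1 i / i.+1] and the subleading coefficient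
    of the Legendre polynomial of degree [i.+1] is [- i.+1 / 2]. *)
Lemma legendre_mx_next i j : j = i.+1 :> nat -> W i j = - (J j i / 2).
Proof.
move=> ji; rewrite mxE ji coef_legendre_sublead.
have lt_in : (i.+1 < n)%N by rewrite -ji.
have -> : c i.+1 = J i.+1 i * c i / i.+1%:R.
  rewrite /c /g krylov_coord_diagS// -/(J i.+1 i) -/(g i i).
  rewrite factS natrM invfM; ring.
have h : i.+1%:R != 0 :> R by rewrite pnatr_eq0.
by move: (i.+1%:R : R) h (c_neq0 i) => s s0 c0; field; rewrite s0 c0.
Qed.

Let gram_leadE i j : gram_lead A b i j = c i * c j / (i + j).+1%:R.
Proof. by rewrite mxE. Qed.
Let gram_nextE i j : gram_next A b i j = (c i * d j + d i * c j) / (i + j).+2%:R.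
Proof. by rewrite mxE. Qed.
Let legendreE i j : W i j = c j / c i * (legendre j : {poly R})`_i.
Proof. by rewrite mxE. Qed.

Lemma legendre_gram_lead :
  W^T *m gram_lead A b *m W = diag_mx (\row_(i < n) l i).
Proof.
apply/matrixP => i j; rewrite conj_mxE [RHS]mxE [X in X *+ _]mxE.
have sz k : (size (legendre k : {poly R}) <= n)%N.
  exact: leq_trans (size_legendre k) (ltn_ord k).
transitivity (c i * c j * integ01 (legendre i * legendre j : {poly R})).
  rewrite (integ01M _ n)// mulr_sumr; apply: eq_bigr => k _.
  rewrite mulr_sumr; apply: eq_bigr => m _; rewrite !legendreE gram_leadE.
  have h : (k + m).+1%:R != 0 :> R by rewrite pnatr_eq0.
  move: ((k + m).+1%:R : R) h (c_neq0 k) (c_neq0 m) => s s0 ck cm.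
  by field; rewrite ck cm s0.
rewrite integ01_legendreM (inj_eq val_inj); case: eqVneq => [->|ij].
  by rewrite mul1r mulr1n -expr2.
by rewrite mul0r mulr0 mulr0n.
Qed.

(** Let [P] be the Legendre polynomial of degree [k] and [e j] the mean of
    [J 0 0, ..., J j j], which is [d j / c j]. The entry is
    [2 * c k ^+ 2] times the integral of [P] against the polynomial of degree
    [k.+1] with coefficients [P`_j * e j] at ['X^j.+1]. By orthogonality its two
    leading terms alone count, and they leave the difference of the sums of
    [k.+1] and [k] diagonal entries of [J]. *)
Lemma legendre_gram_next k : (W^T *m gram_next A b *m W) k k = l k * J k k.
Proof.
rewrite conj_mxE.
pose e (j : nat) : R := (\sum_(m < j.+1) J m m) / j.+1%:R.
have de j : d j = c j * e j.
  rewrite /d /g krylov_coord_supdiag// -/(g j j) /c /e factS natrM invfM.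
  by rewrite [_^-1 / _]mulrC mulrACA.
pose P : {poly R} := legendre k.
have sP : (size P <= n)%N by exact: leq_trans (size_legendre k) (ltn_ord k).
transitivity (c k ^+ 2 * (\sum_(i < n) \sum_(j < n)
    (P`_i * P`_j * e i / (i + j).+2%:R + P`_i * P`_j * e j / (i + j).+2%:R))).
  rewrite mulr_sumr; apply: eq_bigr => i _; rewrite mulr_sumr; apply: eq_bigr => j _.
  rewrite !legendreE gram_nextE !de -/P.
  have h : (i + j).+2%:R != 0 :> R by rewrite pnatr_eq0.
  move: ((i + j).+2%:R : R) h (c_neq0 i) (c_neq0 j) => s s0 ci cj.
  by field; rewrite ci cj s0.
have -> : \sum_(i < n) \sum_(j < n)
    (P`_i * P`_j * e i / (i + j).+2%:R + P`_i * P`_j * e j / (i + j).+2%:R) =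
    2 * \sum_(j < n) P`_j * e j * integ01 (P * 'X^(j.+1)).
  have E : \sum_(i < n) \sum_(j < n) P`_i * P`_j * e j / (i + j).+2%:R =
      \sum_(j < n) P`_j * e j * integ01 (P * 'X^(j.+1)).
    rewrite exchange_big; apply: eq_bigr => j _.
    rewrite (integ01_sum _ n)// mulr_sumr; apply: eq_bigr => i _.
    by rewrite -exprD integ01Xn addnS; ring.
  transitivity (\sum_(i < n) \sum_(j < n) P`_i * P`_j * e i / (i + j).+2%:R +
                \sum_(i < n) \sum_(j < n) P`_i * P`_j * e j / (i + j).+2%:R).
    by rewrite -big_split; apply: eq_bigr => i _; rewrite -big_split.
  rewrite [X in X + _]exchange_big/= -E mulr_natl mulr2n; congr (_ + _).
  apply: eq_bigr => i _; apply: eq_bigr => j _.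
  by rewrite addnC [P`_j * _]mulrC.
have k0 : k.+1%:R != 0 :> R by rewrite pnatr_eq0.
rewrite (bigD1 k)//= integ01_legendre_XnS coef_legendre_lead.
have -> : \sum_(j < n | j != k) P`_j * e j * integ01 (P * 'X^(j.+1)) =
    - ((\sum_(m < k) J m m) / 2 * legendre_sqnorm k).
  have [k00|kgt0] := posnP k.
    rewrite k00 big_ord0 !mul0r oppr0 big1// => j; rewrite -val_eqE/= k00 -lt0n => j0.
    by rewrite /P coef_legendre_gt ?k00// !mul0r.
  have kpn : (k.-1 < n)%N by rewrite (leq_ltn_trans (leq_pred k)).
  rewrite (bigD1 (Ordinal kpn))/=; last by rewrite -val_eqE/=; lia.
  rewrite big1 ?addr0 => [|j /andP[+ +]]; last first.
    rewrite -!val_eqE/= => jk jkp; case: (ltnP k j) => kj.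
      by rewrite /P coef_legendre_gt// !mul0r.
    by rewrite integ01_legendre_Xn_lt ?mulr0//; lia.
  rewrite /e prednK// integ01_legendre_Xn.
  have -> : P`_k.-1 = - (k%:R / 2) by rewrite /P -{1}(prednK kgt0) coef_legendre_sublead prednK.
  have kn0 : (k : nat)%:R != 0 :> R by rewrite pnatr_eq0 -lt0n.
  by field; rewrite kn0.
rewrite /l /ell_lead /e big_ord_recr/=.
by field; rewrite -(natrD _ 1) pnatr_eq0.
Qed.

End LegendreReduction.

(** * Eigenvalues and eigenvectors of the Gramian *)

Section Asymptotics.
Context {R : realType} {n : nat} (A : 'M[R]_n) (b : 'cV[R]_n).
Hypotheses (Ab_kalman : kalman A b) (A_sym : A = A^T).
Implicit Types (i j k : 'I_n) (T t : R).

Let q (i : nat) := krylov_q A b i.+1.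
Let Q := krylov_mx A b.
Let J (i j : nat) := dotp (q i) (A *m q j).
Let W := legendre_mx A b.
Let l := ell_lead A b.
Let G := gramian A b.

(** The conjugate of [W] by the diagonal matrix of the powers [T ^+ i]: it tends to
    the identity because [W] is unit upper triangular. *)
Definition flag_mx T : 'M[R]_n := \matrix_(i, j) (T ^+ (j - i) * W i j).

Definition flag_slope : 'M[R]_n :=
  \matrix_(i, j) (if j == i.+1 :> nat then - (J j i / 2) else 0).

Lemma slope_flag_mx : T^-1 *: (flag_mx T - 1%:M) @[T --> 0^'+] --> flag_slope.
Proof.
apply/cvg_mxP => i j; rewrite mxE.
have E T : (T^-1 *: (flag_mx T - 1%:M)) i j = T^-1 * (T ^+ (j - i) * W i j - (i == j)%:R).
  by rewrite !mxE.
under eq_fun do rewrite E.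
case: (ltngtP i j) => ij.
- have -> : (if j == i.+1 :> nat then - (J j i / 2) else 0) = 0 ^+ (j - i.+1) * W i j.
    rewrite expr0n subn_eq0; case: eqVneq => [e|ne].
      by rewrite -e leqnn mul1r legendre_mx_next.
    by rewrite leqNgt ltn_neqAle eq_sym ne ij/= mul0r.
  apply: (cvg_near_eq _ _ (fun T => T ^+ (j - i.+1) * W i j)).
    apply: filterS (nbhs_right_neq 0) => T T0.
    have -> : (i == j) = false by apply/eqP => e; rewrite e ltnn in ij.
    by rewrite subr0 -(subnSK ij) exprS -mulrA mulKf.
  by apply: cvgM; [exact: cvg_at_right_expr|exact: cvg_cst].
- rewrite legendre_mx_low// ifF; last by apply/eqP; lia.
  have -> : (i == j) = false by apply/eqP => e; rewrite e ltnn in ij.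
  by under eq_fun do rewrite mulr0 subrr mulr0; exact: cvg_cst.
- rewrite ifF; last by apply/eqP; lia.
  have -> : j = i by apply/val_inj.
  under eq_fun do rewrite subnn expr0 mul1r legendre_mx_diag// eqxx subrr mulr0.
  exact: cvg_cst.
Qed.

Let Z T := Q *m flag_mx T.
Let Hh T := W^T *m gram_scaled A b T *m W.
Let S T := (flag_mx T)^T *m flag_mx T.

(** Grading and change of basis commute: [T ^+ i * flag_mx T i k] is
    [W i k * T ^+ k]. *)
Lemma graded_gramian : \forall T \near 0^'+, graded_at G Z Hh S T.
Proof.
have dX : \det (flag_mx T) @[T --> 0^'+] --> (1 : R).
  by rewrite -(det1 R n); apply: cvg_det; exact: cvg_of_slope slope_flag_mx.
have H := cvgr_neq0 _ dX (oner_neq0 R).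
apply: filterS2 (nbhs_right_gt 0) (H _) => T T0 Xu; split => //.
- have : \det (Q^T *m Q) = 1 by rewrite krylov_mx_trK// det1.
  rewrite det_mulmx det_tr => Q1.
  rewrite unitmxE unitfE det_mulmx mulf_neq0//.
  by apply: contra_eqN Q1 => /eqP ->; rewrite mulr0 eq_sym oner_eq0.
- by rewrite /Z trmx_mul mulmxA -[_ *m _ *m Q]mulmxA krylov_mx_trK// mulmx1.
rewrite /Z trmx_mul !mulmxA.
have -> : (flag_mx T)^T *m Q^T *m G T *m Q *m flag_mx T =
  (flag_mx T)^T *m (Q^T *m G T *m Q) *m flag_mx T by rewrite !mulmxA.
have X i k : T ^+ i * flag_mx T i k = T ^+ k * W i k.
  rewrite mxE; case: (leqP i k) => ik; first by rewrite mulrA -exprD subnKC.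
  by rewrite legendre_mx_low// !mulr0.
apply/matrixP => i j; rewrite conj_mxE [RHS]mxE conj_mxE mulr_sumr.
apply: eq_bigr => k _; rewrite mulr_sumr; apply: eq_bigr => m _.
have -> : (Q^T *m G T *m Q) k m = T ^+ (k + m).+1 * gram_scaled A b T k m.
  by rewrite [gram_scaled _ _ _ _ _]mxE mulVKf// expf_neq0// gt_eqF.
move: (gram_scaled A b T k m) => s.
have -> : flag_mx T k i * (T ^+ (k + m).+1 * s) * flag_mx T m j =
   T * (T ^+ k * flag_mx T k i) * (T ^+ m * flag_mx T m j) * s.
  by rewrite exprS exprD; ring.
by rewrite !X exprS exprD; ring.
Qed.

Let H1 := W^T *m gram_next A b *m W.
Let S1 := flag_slope + flag_slope^T.

Lemma slope_reduced_gramian : T^-1 *: (Hh T - diag_mx (\row_(i < n) l i)) @[T --> 0^'+] --> H1.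
Proof.
rewrite -legendre_gram_lead//.
have E T : T^-1 *: (Hh T - W^T *m gram_lead A b *m W) =
    W^T *m (T^-1 *: (gram_scaled A b T - gram_lead A b)) *m W.
  by rewrite -scalemxAr -scalemxAl mulmxBr mulmxBl.
under eq_fun do rewrite E.
apply: cvg_mulmx; last exact: cvg_cst.
by apply: cvg_mulmx; [exact: cvg_cst|exact: slope_gram_scaled].
Qed.

Lemma slope_flag_metric : T^-1 *: (S T - 1%:M) @[T --> 0^'+] --> S1.
Proof.
have -> : S1 = flag_slope^T *m 1%:M + 1%:M^T *m flag_slope.
  by rewrite trmx1 mulmx1 mul1mx addrC.
have E T : T^-1 *: (S T - 1%:M) = T^-1 *: (S T - 1%:M^T *m 1%:M).
  by rewrite trmx1 mulmx1.
under eq_fun do rewrite E.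
exact: cvg_slope_mulmx (cvg_slope_trmx _ _ _ _ _ slope_flag_mx) slope_flag_mx.
Qed.

Lemma S1_diag i : S1 i i = 0.
Proof. by rewrite !mxE ltn_eqF// addr0. Qed.

Let lam k T := nth 0 (eigvals (G T)) k.
Let l_gt0 := ell_lead_gt0 A b Ab_kalman.
Let cvgHh := cvg_of_slope _ _ _ _ slope_reduced_gramian.
Let cvgS := cvg_of_slope _ _ _ _ slope_flag_metric.

Lemma cvg_eigval k : T ^- (2 * k).+1 * lam k T @[T --> 0^'+] --> l k.
Proof. exact: cvg_scaled_eigval l_gt0 graded_gramian cvgHh cvgS k. Qed.

Lemma slope_eigval k :
  T^-1 * (T ^- (2 * k).+1 * lam k T - l k) @[T --> 0^'+] --> l k * J k k.
Proof.
rewrite -legendre_gram_next//.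
exact: slope_scaled_eigval l_gt0 graded_gramian cvgHh cvgS _ _
  slope_reduced_gramian slope_flag_metric S1_diag k.
Qed.

Definition eigvec k T : 'cV[R]_n := Z T *m graded_vec G Hh S k T.

Lemma eigvecE k : \forall T \near 0^'+, G T *m eigvec k T = lam k T *: eigvec k T.
Proof. exact: graded_eigenvector l_gt0 graded_gramian cvgHh cvgS k. Qed.

Lemma eigval_inj : \forall T \near 0^'+,
  forall i j, lam i T = lam j T -> i = j.
Proof.
by apply: filterS (spectrum_near _ _ _ _ _ l_gt0 graded_gramian cvgHh cvgS 1 ltr01) => T [].
Qed.

(** Antisymmetric generator of the rotation of the eigenvectors at [T = 0], in the
    Krylov basis. Its nonzero entries are half of those of [J] next to the
    diagonal, up to sign. *)
Definition rotation_mx : 'M[R]_n := flag_slope - flag_slope^T.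
Let N := rotation_mx.

(** The change of basis contributes the upper half of the generator and the
    eigenvector in the graded basis contributes its lower half. *)
Lemma slope_eigvec k :
  T^-1 *: (eigvec k T - q k) @[T --> 0^'+] --> Q *m (N *m delta_mx k 0).
Proof.
have slopeZ : T^-1 *: (Z T - Q) @[T --> 0^'+] --> Q *m flag_slope.
  have E T : T^-1 *: (Z T - Q) = Q *m (T^-1 *: (flag_mx T - 1%:M)).
    by rewrite -scalemxAr mulmxBr mulmx1.
  under eq_fun do rewrite E.
  by apply: cvg_mulmx; [exact: cvg_cst|exact: slope_flag_mx].
have := cvg_slope_mulmx _ _ _ _ _ _ _ _ _ slopeZ
  (slope_graded_vec _ _ _ _ _ l_gt0 graded_gramian cvgHh cvgS _ _
    slope_reduced_gramian slope_flag_metric k).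
have -> : Q *m delta_mx k 0 = q k by rewrite -colE col_krylov_mx.
rewrite -mulmxA -mulmxDr.
suff -> : flag_slope *m delta_mx k 0 + \col_i (if (k < i)%N then - S1 i k else 0) =
  N *m delta_mx k 0 by [].
rewrite -!colE; apply/matrixP => i j; rewrite !mxE.
case: (ltnP k i) => ki; last by rewrite addr0 [X in _ - X]ifF ?subr0//; apply/eqP; lia.
by rewrite ifF ?add0r//; apply/eqP; lia.
Qed.

(** The normalizing factor has slope 0, because the eigenvector moves
    orthogonally to [q k]. *)
Lemma slope_eigvec_outer k :
  T^-1 *: ((dotp (eigvec k T) (eigvec k T))^-1 *: (eigvec k T *m (eigvec k T)^T)
           - q k *m (q k)^T) @[T --> 0^'+] -->
  Q *m (N *m delta_mx k k - delta_mx k k *m N) *m Q^T.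
Proof.
set v := eigvec k; pose d : 'cV[R]_n := Q *m (N *m delta_mx k 0).
have qk : Q *m delta_mx k 0 = q k by rewrite -colE col_krylov_mx.
have sv : T^-1 *: (v T - q k) @[T --> 0^'+] --> d := slope_eigvec k.
have svT := cvg_slope_trmx _ _ _ _ _ sv.
have NT : N^T = - N by rewrite /N /rotation_mx linearB/= trmxK opprB.
have dq : d^T *m q k + (q k)^T *m d = 0.
  have -> : d^T *m q k = ((q k)^T *m d)^T by rewrite [RHS]trmx_mul trmxK.
  rewrite [X in X^T + X](_ : _ = 0) ?trmx0 ?addr0//.
  rewrite -qk /d trmx_mul mulmxA -[_ *m Q^T *m Q]mulmxA krylov_mx_trK// mulmx1.
  rewrite -colE trmx_delta -rowE; apply/matrixP => i j; rewrite !ord1 !mxE.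
  by rewrite ltn_eqF// subrr.
have s1 : dotp (q k) (q k) = 1 by rewrite krylov_q_orthonormal// eqxx.
have sdot : T^-1 * (dotp (v T) (v T) - 1) @[T --> 0^'+] --> (0 : R).
  have := cvg_mx_entry _ _ _ _ (cvg_slope_mulmx _ _ _ _ _ _ _ _ _ svT sv) 0 0.
  rewrite dq mxE => H.
  have E T : T^-1 * (dotp (v T) (v T) - 1) = (T^-1 *: ((v T)^T *m v T - (q k)^T *m q k)) 0 0.
    by rewrite !mxE -!/(dotp _ _) dotpE mxE -[X in _ - X]s1 dotpE mxE.
  by under eq_fun do rewrite E; exact: H.
have souter : T^-1 *: (v T *m (v T)^T - q k *m (q k)^T) @[T --> 0^'+] -->
    Q *m (N *m delta_mx k k - delta_mx k k *m N) *m Q^T.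
  have := cvg_slope_mulmx _ _ _ _ _ _ _ _ _ sv svT.
  suff -> : d *m (q k)^T + q k *m d^T =
    Q *m (N *m delta_mx k k - delta_mx k k *m N) *m Q^T by [].
  rewrite -qk /d !trmx_mul NT.
  have kk : delta_mx k k = delta_mx k (0 : 'I_1) *m (delta_mx k 0)^T :> 'M[R]_n.
    by rewrite trmx_delta mul_delta_mx.
  rewrite kk; move: (N) => M.
  by rewrite mulmxBr mulmxBl !(mulmxN, mulNmx) !mulmxA.
have cdot : dotp (v T) (v T) @[T --> 0^'+] --> (1 : R).
  exact: (@cvg_of_slope R R^o _ _ _ sdot).
have cdot0 := cvgr_neq0 _ cdot (oner_neq0 R).
have c1 : (dotp (v T) (v T))^-1 @[T --> 0^'+] --> (1 : R).
  by rewrite -[X in _ --> X]invr1; apply: cvgV cdot; exact: oner_neq0.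
have c2 : - (T^-1 * (dotp (v T) (v T) - 1)) / dotp (v T) (v T) @[T --> 0^'+] --> (0 : R).
  rewrite -[X in _ --> X](_ : - 0 * 1 = 0); last by rewrite oppr0 mul0r.
  by apply: cvgM c1; exact: cvgN.
move: souter; move: (Q *m _ *m Q^T) => L souter.
have -> : L = 1 *: L + 0 *: (q k *m (q k)^T) by rewrite scale1r scale0r addr0.
apply: (cvg_near_eq _ _ (fun T =>
   (dotp (v T) (v T))^-1 *: (T^-1 *: (v T *m (v T)^T - q k *m (q k)^T))
   + (- (T^-1 * (dotp (v T) (v T) - 1)) / dotp (v T) (v T)) *: (q k *m (q k)^T))).
  apply: filterS2 (cdot0 _) (nbhs_right_neq 0) => T v0 T0.
  move: (v T *m (v T)^T) (q k *m (q k)^T) (dotp (v T) (v T)) v0 => M M' s v0.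
  by apply/matrixP => i j; rewrite !mxE; field; rewrite v0 T0.
apply: cvgD; first exact: cvgZ c1 souter.
by apply: cvgZ c2 _; exact: cvg_cst.
Qed.

End Asymptotics.

(** * Projectors and Jacobi coefficients *)

Lemma gramian_tr (R : realType) n (A : 'M[R]_n) b T : (gramian A b T)^T = gramian A b T.
Proof.
apply/matrixP => i j; rewrite !mxE; apply: eq_Rintegral => t _.
rewrite -expmx_tr -[_ *m b^T *m _]mulmxA -trmx_mul.
move: (expmx _ *m b) => z; rewrite !mxE; apply: eq_bigr => k _.
by rewrite !mxE mulrC.
Qed.

Lemma mulmx_delta_diag (R : comNzRingType) n (M : 'M[R]_n) (m i j : 'I_n) :
  (M *m delta_mx m m) i j = M i j * (m == j)%:R.
Proof.
rewrite mxE (bigD1 m)//= mxE eqxx/= big1 => [|p /negbTE pm]; last first.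
  by rewrite mxE pm mulr0.
by rewrite addr0 eq_sym; case: eqVneq => [->|]; rewrite ?mulr0.
Qed.

Lemma delta_diag_mulmx (R : comNzRingType) n (M : 'M[R]_n) (m i j : 'I_n) :
  (delta_mx m m *m M) i j = M i j * (m == i)%:R.
Proof.
rewrite mxE (bigD1 m)//= mxE eqxx/= big1 => [|p /negbTE pm]; last first.
  by rewrite mxE pm andbF mul0r.
by rewrite andbT addr0 eq_sym mulrC; case: eqVneq => [->|]; rewrite ?mulr0.
Qed.

Section Projectors.
Context {R : realType} {n : nat} (A : 'M[R]_n) (b : 'cV[R]_n).
Hypotheses (Ab_kalman : kalman A b) (A_sym : A = A^T).
Implicit Types (i j k : 'I_n) (T t : R) (K : nat).

Let q (i : nat) := krylov_q A b i.+1.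
Let Q := krylov_mx A b.
Let J (i j : nat) := dotp (q i) (A *m q j).
Let N := rotation_mx A b.

(** Limit of [Pi A b K T]: the projector onto the Krylov space of dimension [K]. *)
Definition flag_proj K : 'M[R]_n := \sum_(i < n | (i < K)%N) q i *m (q i)^T.

Definition flag_proj_slope K : 'M[R]_n :=
  Q *m (\sum_(i < n | (i < K)%N) (N *m delta_mx i i - delta_mx i i *m N)) *m Q^T.

Lemma Pi_near K : (K <= n)%N -> \forall T \near 0^'+, Pi A b K T =
  \sum_(i < n | (i < K)%N) (dotp (eigvec A b i T) (eigvec A b i T))^-1 *:
    (eigvec A b i T *m (eigvec A b i T)^T).
Proof.
move=> Kn; have near_eig : \forall T \near 0^'+, forall i,
    gramian A b T *m eigvec A b i T =
    nth 0 (eigvals (gramian A b T)) i *: eigvec A b i T.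
  by apply: filter_forall => i; exact: eigvecE.
have near_neq0 : \forall T \near 0^'+, forall i, eigvec A b i T != 0.
  apply: filter_forall => i.
  have cq : eigvec A b i T @[T --> 0^'+] --> q i.
    exact: cvg_of_slope (slope_eigvec A b Ab_kalman A_sym i).
  have q0 : q i != 0.
    by rewrite -dotp_eq0 krylov_q_orthonormal// eqxx oner_eq0.
  by have := cvgr_neq0 _ cq q0; apply.
apply: filterS3 near_eig near_neq0 (eigval_inj A b Ab_kalman A_sym) => T GV V0 inj.
rewrite /Pi (orthproj_eigenspaces _ (fun m : nat => nth 0 (eigvals (gramian A b T)) m)
  (fun i => eigvec A b i T))//.
by rewrite gramian_tr.
Qed.

Lemma slope_Pi K : (K <= n)%N ->
  T^-1 *: (Pi A b K T - flag_proj K) @[T --> 0^'+] --> flag_proj_slope K.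
Proof.
move=> Kn.
apply: (cvg_near_eq _ _ (fun T => \sum_(i < n | (i < K)%N)
  T^-1 *: ((dotp (eigvec A b i T) (eigvec A b i T))^-1 *:
    (eigvec A b i T *m (eigvec A b i T)^T) - q i *m (q i)^T))).
  by apply: filterS (Pi_near K Kn) => T ->; rewrite -sumrB scaler_sumr.
rewrite /flag_proj_slope mulmx_sumr mulmx_suml.
by apply: cvg_sum => i _; exact: slope_eigvec_outer.
Qed.

Lemma Pi0E K : (K <= n)%N -> Pi0 A b K = flag_proj K.
Proof.
move=> Kn; rewrite /Pi0; case: eqVneq => [->|K0].
  by rewrite /flag_proj big_pred0.
case: eqVneq => [->|KN].
  rewrite -(krylov_mxK A b Ab_kalman) -/Q /flag_proj.
  apply/matrixP => r s; rewrite mxE summxE.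
  rewrite [RHS](eq_bigl (fun i : 'I_n => true)); last by move=> i; rewrite ltn_ord.
  by apply: eq_bigr => i _; rewrite !mxE big_ord1 !mxE.
apply: cvg_lim; first exact: norm_hausdorff.
exact: cvg_of_slope (slope_Pi K Kn).
Qed.

Lemma cvg_Pi K : (K <= n)%N -> Pi A b K T @[T --> 0^'+] --> Pi0 A b K.
Proof. by move=> Kn; rewrite Pi0E//; exact: cvg_of_slope (slope_Pi K Kn). Qed.

Lemma dPi0E K : (K <= n)%N -> dPi0 A b K = flag_proj_slope K.
Proof.
move=> Kn; rewrite /dPi0 Pi0E//.
apply: cvg_lim; first exact: norm_hausdorff.
exact: slope_Pi.
Qed.

Lemma cvg_dPi K : (K <= n)%N ->
  T^-1 *: (Pi A b K T - Pi0 A b K) @[T --> 0^'+] --> dPi0 A b K.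
Proof. by move=> Kn; rewrite dPi0E// Pi0E//; exact: slope_Pi. Qed.

Lemma eigval_exponentE (i : nat) : (2 * i.+1 - 1 = (2 * i).+1)%N. Proof. lia. Qed.

Lemma cvg_ell i :
  T ^- (2 * i.+1 - 1) * lambda A b i.+1 T @[T --> 0^'+] --> ell_lead A b i.
Proof. by rewrite eigval_exponentE; exact: cvg_eigval. Qed.

Lemma ellE i : ell A b i.+1 = ell_lead A b i.
Proof. by apply: cvg_lim; [exact: norm_hausdorff|exact: cvg_ell]. Qed.

Lemma cvg_rcoef i :
  T^-1 * (lambda A b i.+1 T / (ell A b i.+1 * T ^+ (2 * i.+1 - 1)) - 1)
    @[T --> 0^'+] --> jac_a A b i.+1.
Proof.
have l0 : ell_lead A b i != 0 by rewrite gt_eqF// ell_lead_gt0.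
rewrite ellE eigval_exponentE.
have E T : T^-1 * (lambda A b i.+1 T / (ell_lead A b i * T ^+ (2 * i).+1) - 1) =
   (ell_lead A b i)^-1 *
   (T^-1 * (T ^- (2 * i).+1 * nth 0 (eigvals (gramian A b T)) i - ell_lead A b i)).
  rewrite [RHS]mulrCA; congr (_ * _); rewrite [RHS]mulrBr mulVf// invfM.
  by rewrite -[nth _ _ _]/(lambda A b i.+1 T); ring.
under eq_fun do rewrite E.
have -> : jac_a A b i.+1 = (ell_lead A b i)^-1 * (ell_lead A b i * J i i).
  by rewrite mulKf.
by apply: cvgM; [exact: cvg_cst|exact: slope_eigval].
Qed.

Lemma rcoefE i : rcoef A b i.+1 = jac_a A b i.+1.
Proof. by apply: cvg_lim; [exact: norm_hausdorff|exact: cvg_rcoef]. Qed.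


Lemma jac_beta_gt0 (i : nat) : (i.+1 < n)%N -> 0 < jac_beta A b i.+1.
Proof.
move=> lt_in; have g1 := krylov_coord_diag_gt0 A b Ab_kalman _ lt_in.
have g0 := krylov_coord_diag_gt0 A b Ab_kalman _ (ltnW lt_in).
have := krylov_coord_diagS A b Ab_kalman A_sym _ lt_in => E.
by move: g1; rewrite E pmulr_lgt0.
Qed.

(** [kappa R i.+1] is the square norm of the Legendre polynomial of degree [i]
    divided by [i`! ^ 2]. *)
Lemma ell_kappa (i : nat) :
  ell_lead A b i = dotp (q i) (A ^+ i *m b) ^+ 2 * kappa R i.+1.
Proof.
rewrite /ell_lead /legendre_sqnorm /kappa.
have -> : (i.+1 - 1 = i)%N by lia.
have -> : (2 * i.+1 - 1 = (2 * i).+1)%N by lia.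
have -> : (2 * i.+1 - 2 = 2 * i)%N by lia.
rewrite -/(q i) mulnC natrX.
have f0 m : m`!%:R != 0 :> R by rewrite pnatr_eq0 -lt0n fact_gt0.
have := f0 i; have : (((2 * i).+1)`! * (2 * i)`!)%:R != 0 :> R.
  by rewrite natrM mulf_neq0.
move: (((2 * i).+1)`! * (2 * i)`!)%:R => X X0 i0.
by field; rewrite X0 i0.
Qed.

Lemma jac_beta_ell (i : nat) : (i.+1 < n)%N -> jac_beta A b i.+1 =
  Num.sqrt ((kappa R i.+1 * ell A b i.+2) / (kappa R i.+2 * ell A b i.+1)).
Proof.
move=> lt_in; have lt_in' := ltnW lt_in.
rewrite (ellE (Ordinal lt_in)) (ellE (Ordinal lt_in'))/= !ell_kappa.
have g0 := krylov_coord_diag_gt0 A b Ab_kalman _ lt_in'.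
rewrite (krylov_coord_diagS A b Ab_kalman A_sym _ lt_in).
have K0 m : kappa R m != 0.
  rewrite /kappa mulf_neq0 ?invr_eq0 ?pnatr_eq0//.
  by rewrite -lt0n expn_gt0 fact_gt0.
  by rewrite -lt0n muln_gt0 !fact_gt0.
have g0' : dotp (q i) (A ^+ i *m b) != 0 by rewrite gt_eqF.
have -> : kappa R i.+1 * ((jac_beta A b i.+1 * dotp (q i) (A ^+ i *m b)) ^+ 2 * kappa R i.+2) /
   (kappa R i.+2 * (dotp (q i) (A ^+ i *m b) ^+ 2 * kappa R i.+1)) = jac_beta A b i.+1 ^+ 2.
  by field; rewrite !K0 g0'.
by rewrite sqrtr_sqr ger0_norm// ltW// jac_beta_gt0.
Qed.

Lemma norm2_b_ell : (0 < n)%N -> norm2 b = Num.sqrt (ell A b 1).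
Proof.
move=> n0; rewrite (ellE (Ordinal n0))/= ell_kappa krylov_coord0// /kappa.
by rewrite subn1 /= !fact0 exp1n divr1 mulr1 sqrtr_sqr ger0_norm// sqrtr_ge0.
Qed.

Lemma outer_b_Pi0 : (0 < n)%N -> b *m b^T = ell A b 1 *: Pi0 A b 1.
Proof.
move=> n0; rewrite Pi0E// /flag_proj (big_pred1 (Ordinal n0)); last first.
  by move=> i /=; rewrite -val_eqE/= ltnS leqn0.
have -> : ell A b 1 = norm2 b ^+ 2.
  rewrite norm2_b_ell// sqr_sqrtr// (ellE (Ordinal n0)) ltW//.
  exact: ell_lead_gt0.
rewrite {1 2}(krylov_q0 A b Ab_kalman n0) [(_ *: _)^T]linearZ/=.
by rewrite -scalemxAl -scalemxAr scalerA -expr2.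
Qed.

Lemma kalman_neq0 : (0 < n)%N -> b != 0.
Proof.
move=> n0; apply/eqP => b0; apply: (kalman_free A b Ab_kalman 0 n0).
by exists (fun=> 0); rewrite big_ord0 b0 mulmx0.
Qed.

Lemma jacobi_mxE : Q^T *m A *m Q = \matrix_(i, j) J i j.
Proof. by apply/matrixP => i j; rewrite krylov_mx_conjE !mxE. Qed.

(** In the Krylov basis the first sum is the diagonal of [J]. With [I k] the
    projector on the first [k] coordinates, the [k]-th slope is the commutator of
    [N] with [I k]: as [N] is supported next to the diagonal, only the pair
    of entries [(k.-1, k)] and [(k, k.-1)] survives, both equal to half of
    [J k k.-1]. *)
Lemma jacobi_decomposition :
  A = \sum_(1 <= k < n.+1) rcoef A b k *: (Pi0 A b k - Pi0 A b k.-1)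
      + 2 *: \sum_(1 <= k < n) dPi0 A b k.
Proof.
have QK := krylov_mxK A b Ab_kalman; have KQ := krylov_mx_trK A b Ab_kalman.
rewrite big_add1/= big_mkord.
rewrite (eq_bigr (fun i : 'I_n => J i i *: (q i *m (q i)^T))); last first.
  move=> i _; rewrite rcoefE !Pi0E// ?(ltnW (ltn_ord i))//=; congr (_ *: _).
  rewrite /flag_proj (bigD1 i)//= [X in _ + X - _](eq_bigl (fun j : 'I_n => (j < i)%N)).
    by rewrite addrK.
  by move=> j; rewrite ltnS ltn_neqAle andbC.
rewrite (eq_big_nat _ _ (F2 := flag_proj_slope)); last first.
  by move=> k /andP[_ kn]; rewrite dPi0E// ltnW.
pose F (k : nat) : 'M[R]_n := \sum_(i < n | (i < k)%N) (N *m delta_mx i i - delta_mx i i *m N).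
have FE (k : nat) i j : F k i j = N i j * ((j < k)%:R - (i < k)%:R).
  have cnt (m : 'I_n) : \sum_(p < n | (p < k)%N) (p == m)%:R = (m < k)%:R :> R.
    rewrite big_mkcond (bigD1 m)//= eqxx big1 ?addr0; first by case: ifP.
    by move=> p /negbTE ->; case: ifP.
  rewrite summxE -!cnt -sumrB mulr_sumr; apply: eq_bigr => m _; rewrite mulrBr.
  by rewrite mxE [X in _ + X]mxE mulmx_delta_diag delta_diag_mulmx.
have -> : \sum_(i < n) J i i *: (q i *m (q i)^T) = Q *m diag_mx (\row_i J i i) *m Q^T.
  apply/matrixP => r s; rewrite summxE mul_mx_diag mxE; apply: eq_bigr => i _.
  by rewrite !mxE big_ord1 !mxE mulrCA mulrA.
have -> : \sum_(1 <= k < n) flag_proj_slope k = Q *m (\sum_(1 <= k < n) F k) *m Q^T.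
  by rewrite mulmx_sumr mulmx_suml.
rewrite scalemxAl scalemxAr -mulmxDl -mulmxDr.
have -> : diag_mx (\row_i J i i) + 2 *: \sum_(1 <= k < n) F k = Q^T *m A *m Q.
  rewrite jacobi_mxE; apply/matrixP => i j; rewrite [RHS]mxE mxE [X in _ + X]mxE.
  rewrite summxE [diag_mx _ _ _]mxE [X in X *+ _]mxE.
  under eq_bigr do rewrite FE.
  rewrite -mulr_sumr.
  have cnt (m : 'I_n) : (0 < m)%N -> \sum_(1 <= k < n) (k == m)%:R = 1 :> R.
    move=> m0; rewrite (bigD1_seq (m : nat)) ?iota_uniq ?mem_index_iota ?m0 ?ltn_ord//=.
    by rewrite eqxx big1 ?addr0// => k /negbTE ->.
  have NE : N i j = (if j == i.+1 :> nat then - (J j i / 2) else 0) -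
                    (if i == j.+1 :> nat then - (J i j / 2) else 0) by rewrite !mxE.
  case: (ltngtP i j) => ij.
  - have -> : (i == j) = false by apply/eqP => e; rewrite e ltnn in ij.
    rewrite mulr0n add0r NE [X in _ - X]ifF; last by apply/eqP; lia.
    case: eqP => [e|ne]; last first.
      have -> : J i j = 0 by apply: (jacobi_tridiag A b Ab_kalman A_sym) => //; lia.
      by rewrite subr0 mul0r mulr0.
    rewrite (eq_bigr (fun k : nat => - ((k == j :> nat)%:R))) => [|k _]; last first.
      have -> : (i < k)%N = (k == i.+1) || (i.+1 < k)%N by lia.
      by rewrite e; case: ltngtP; rewrite /= ?subrr ?subr0 ?sub0r ?oppr0.
    rewrite sumrN cnt ?(leq_ltn_trans _ ij)// (_ : J i j = J j i); last exact: jacobi_sym.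
    by field.
  - have -> : (i == j) = false by apply/eqP => e; rewrite e ltnn in ij.
    rewrite mulr0n add0r NE [X in X - _]ifF; last by apply/eqP; lia.
    case: eqP => [e|ne]; last first.
      have -> : J i j = 0 by apply: (jacobi_tridiag A b Ab_kalman A_sym) => //; lia.
      by rewrite subr0 mul0r mulr0.
    rewrite (eq_bigr (fun k : nat => (k == i :> nat)%:R)) => [|k _]; last first.
      have -> : (j < k)%N = (k == j.+1) || (j.+1 < k)%N by lia.
      by rewrite e; case: ltngtP; rewrite /= ?subrr ?subr0 ?sub0r ?oppr0.
    rewrite cnt ?(leq_ltn_trans _ ij)//.
    by field.
  - have -> : j = i by apply/val_inj.
    by rewrite eqxx mulr1n big1 ?mulr0 ?addr0// => k _; rewrite subrr.
by rewrite !mulmxA QK mul1mx -mulmxA QK mulmx1.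
Qed.

End Projectors.

(** * Reconstruction of the pair *)

(** The diagonal entries agree up to sign, and a row of the equality through a
    nonzero entry spreads that sign to the whole vector. *)
Lemma outer_eq_sign (R : realType) n (x y : 'cV[R]_n) :
  x *m x^T = y *m y^T -> y = x \/ y = - x.
Proof.
move=> /matrixP E; have {}E i j : x i 0 * x j 0 = y i 0 * y j 0.
  by have := E i j; rewrite !mxE !big_ord1 !mxE.
have [x0|/eqP x0] := eqVneq x 0.
  left; apply/matrixP => i j; rewrite ord1; apply/eqP.
  by have := E i i; rewrite x0 mxE mulr0 => /esym/eqP; rewrite mulf_eq0 orbb.
have [i xi] : exists i, x i 0 != 0.
  apply/existsP; apply: contraT; rewrite negb_exists => /forallP H.
  case: x0; apply/matrixP => i j; rewrite ord1 mxE; apply/eqP.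
  by have := H i; rewrite negbK.
have := E i i; move/eqP; rewrite -!expr2 eqf_sqr => /orP[] /eqP xy.
  left; apply/matrixP => j z; rewrite ord1; apply: (mulfI xi).
  by rewrite [in LHS]xy -E.
right; apply/matrixP => j z; rewrite ord1 mxE; apply: (mulfI xi).
by rewrite [in LHS]xy mulNr -E mulrN.
Qed.

Lemma kalmanN (R : realType) n (A : 'M[R]_n) b : kalman A b -> kalman A (- b).
Proof.
move=> Ab; rewrite /kalman -[RHS]Ab -[RHS]mxrank_opp; congr (\rank _).
by apply/matrixP => i j; rewrite !mxE -sumrN; apply: eq_bigr => k _; rewrite mxE mulrN.
Qed.

Lemma gramianN (R : realType) n (A : 'M[R]_n) b T : gramian A (- b) T = gramian A b T.
Proof.
apply/matrixP => i j; rewrite mxE [RHS]mxE; apply: eq_Rintegral => t _.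
have -> : (- b)^T = - b^T by rewrite linearN.
by rewrite !(mulmxN, mulNmx) opprK.
Qed.

(** In its own Krylov basis each pair becomes its Jacobi matrix together with a
    multiple of the first basis vector, so the change of Krylov basis
    conjugates one pair into the other. *)
Lemma krylov_conjugate (R : realType) n (A A' : 'M[R]_n) (b b' : 'cV[R]_n) :
  (0 < n)%N -> A = A^T -> A' = A'^T -> kalman A b -> kalman A' b' ->
  norm2 b' = norm2 b ->
  (forall i j : 'I_n, dotp (krylov_q A' b' i.+1) (A' *m krylov_q A' b' j.+1) =
                      dotp (krylov_q A b i.+1) (A *m krylov_q A b j.+1)) ->
  let O := krylov_mx A' b' *m (krylov_mx A b)^T in
  [/\ O *m O^T = 1%:M, A' = O *m A *m O^T & b' = O *m b].
Proof.
move=> n0 As A's Ab A'b' nb JJ O.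
have QK := krylov_mxK A b Ab; have KQ := krylov_mx_trK A b Ab.
have QK' := krylov_mxK A' b' A'b'; have KQ' := krylov_mx_trK A' b' A'b'.
have OT : O^T = krylov_mx A b *m (krylov_mx A' b')^T by rewrite trmx_mul trmxK.
have J : (krylov_mx A' b')^T *m A' *m krylov_mx A' b' =
         (krylov_mx A b)^T *m A *m krylov_mx A b.
  by rewrite !jacobi_mxE; apply/matrixP => i j; rewrite [LHS]mxE [RHS]mxE; exact: JJ.
split.
- by rewrite OT /O mulmxA -[_ *m _ *m krylov_mx A b]mulmxA KQ mulmx1.
- have -> : O *m A *m O^T = krylov_mx A' b' *m ((krylov_mx A b)^T *m A *m krylov_mx A b)
    *m (krylov_mx A' b')^T by rewrite OT /O !mulmxA.
  by rewrite -J !mulmxA QK' mul1mx -mulmxA QK' mulmx1.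
rewrite (krylov_q0 A b Ab n0) (krylov_q0 A' b' A'b' n0) nb -scalemxAr; congr (_ *: _).
have -> : krylov_q A b 1 = col (Ordinal n0) (krylov_mx A b) by rewrite col_krylov_mx.
by rewrite colE /O -!mulmxA [(krylov_mx A b)^T *m _]mulmxA KQ mul1mx -colE col_krylov_mx.
Qed.

Lemma krylov_data_eq (R : realType) n (A A' : 'M[R]_n) (b b' : 'cV[R]_n) :
  A = A^T -> A' = A'^T -> kalman A b -> kalman A' b' ->
  (forall k, (1 <= k <= n)%N -> jac_a A' b' k = jac_a A b k) ->
  (forall k, (1 <= k <= n - 1)%N -> jac_beta A' b' k = jac_beta A b k) ->
  forall i j : 'I_n, dotp (krylov_q A' b' i.+1) (A' *m krylov_q A' b' j.+1) =
                     dotp (krylov_q A b i.+1) (A *m krylov_q A b j.+1).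
Proof.
move=> As A's Ab A'b' Ha Hb i j.
have [ij|] := boolP ((j.+1 < i)%N || (i.+1 < j)%N).
  by rewrite (jacobi_tridiag A b)// (jacobi_tridiag A' b').
rewrite negb_or -!leqNgt => /andP[ij ji].
have lower (k m : 'I_n) : k = m.+1 :> nat ->
    dotp (krylov_q A' b' k.+1) (A' *m krylov_q A' b' m.+1) =
    dotp (krylov_q A b k.+1) (A *m krylov_q A b m.+1).
  by move=> e; rewrite e; apply: Hb; have := ltn_ord k; lia.
case: (ltngtP i j) => h.
- by rewrite (jacobi_sym A b As) (jacobi_sym A' b' A's); apply: lower; lia.
- by apply: lower; lia.
- by rewrite h; apply: Ha; have := ltn_ord j; lia.
Qed.

Theorem proposition11 (R : realType) (n : nat) (n_gt0 : (0 < n)%N)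
    (A : 'M[R]_n) (b : 'cV[R]_n) (A_sym : A = A^T) (Ab_kalman : kalman A b) :
  (* the limits defining ell_k and r_k exist, and ell_k can be divided by *)
  (forall k : nat, (1 <= k <= n)%N ->
     [/\ T ^- (2 * k - 1) * lambda A b k T @[T --> 0^'+] --> ell A b k,
         0 < ell A b k &
         T^-1 * (lambda A b k T / (ell A b k * T ^+ (2 * k - 1)) - 1)
           @[T --> 0^'+] --> rcoef A b k]) /\
  (forall k : nat, (1 <= k <= n)%N -> rcoef A b k = jac_a A b k) /\
  (forall k : nat, (1 <= k <= n - 1)%N ->
     jac_beta A b k =
     Num.sqrt ((kappa R k * ell A b k.+1) / (kappa R k.+1 * ell A b k))) /\
  (* the scalar coefficients determine (A, b) up to orthogonal change of
     coordinates and sign of b *)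
  (forall (A' : 'M[R]_n) (b' : 'cV[R]_n), A' = A'^T -> kalman A' b' ->
     (forall k : nat, (1 <= k <= n)%N ->
        ell A' b' k = ell A b k /\ rcoef A' b' k = rcoef A b k) ->
     exists Q : 'M[R]_n, Q *m Q^T = 1%:M /\ A' = Q *m A *m Q^T /\
       (b' = Q *m b \/ b' = - (Q *m b))) /\
  (* the limits defining the projector data exist *)
  (forall k : nat, (1 <= k <= n - 1)%N ->
     Pi A b k T @[T --> 0^'+] --> Pi0 A b k /\
     T^-1 *: (Pi A b k T - Pi0 A b k) @[T --> 0^'+] --> dPi0 A b k) /\
  A = \sum_(1 <= k < n.+1) rcoef A b k *: (Pi0 A b k - Pi0 A b k.-1)
      + 2 *: \sum_(1 <= k < n) dPi0 A b k /\
  norm2 b = Num.sqrt (ell A b 1) /\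
  (* ell_1 and Pi_1^0 determine b up to its sign *)
  (forall (A' : 'M[R]_n) (b' : 'cV[R]_n), A' = A'^T -> kalman A' b' ->
     ell A' b' 1 = ell A b 1 -> Pi0 A' b' 1 = Pi0 A b 1 ->
     b' = b \/ b' = - b) /\
  (* the sign of b cannot be recovered from the Gramian *)
  (kalman A (- b) /\ - b <> b /\
   forall T : R, 0 < T -> gramian A (- b) T = gramian A b T).
Proof.
have rE (A' : 'M[R]_n) (b' : 'cV[R]_n) (A's : A' = A'^T) (A'b' : kalman A' b') k :
    (1 <= k <= n)%N ->
    rcoef A' b' k = jac_a A' b' k.
  by case: k => // k /= kn; exact: (rcoefE A' b' A'b' A's (Ordinal kn)).
have betaE (A' : 'M[R]_n) (b' : 'cV[R]_n) (A's : A' = A'^T) (A'b' : kalman A' b') k :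
    (1 <= k <= n - 1)%N ->
    jac_beta A' b' k =
    Num.sqrt ((kappa R k * ell A' b' k.+1) / (kappa R k.+1 * ell A' b' k)).
  by case: k => // k /= kn; apply: jac_beta_ell => //; lia.
split.
  case=> // k /= kn; have kE := ellE A b Ab_kalman A_sym (Ordinal kn).
  split.
  - by rewrite kE; exact: (cvg_ell A b Ab_kalman A_sym (Ordinal kn)).
  - by rewrite kE; exact: (ell_lead_gt0 A b Ab_kalman (Ordinal kn)).
  - by rewrite rE//; exact: (cvg_rcoef A b Ab_kalman A_sym (Ordinal kn)).
split; first exact: rE.
split; first exact: betaE.
split.
  move=> A' b' A's A'b' H.
  have nb : norm2 b' = norm2 b.
    have [e1 _] := H 1%N n_gt0.
    have E' := norm2_b_ell A' b' A'b' A's n_gt0; rewrite e1 in E'.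
    exact: etrans E' (esym (norm2_b_ell A b Ab_kalman A_sym n_gt0)).
  have [] := krylov_conjugate _ _ A A' b b' n_gt0 A_sym A's Ab_kalman A'b' nb.
    apply: krylov_data_eq => // k kn.
      have [_ rk] := H k kn; rewrite (rE _ _ A's A'b' k kn) in rk.
      exact: etrans rk (rE _ _ A_sym Ab_kalman k kn).
    have k1 : (1 <= k <= n)%N by lia.
    have k2 : (1 <= k.+1 <= n)%N by lia.
    have [h1 _] := H k k1; have [h2 _] := H k.+1 k2.
    have E' := betaE _ _ A's A'b' k kn; rewrite h1 h2 in E'.
    exact: etrans E' (esym (betaE _ _ A_sym Ab_kalman k kn)).
  move=> OO AO bO; exists (krylov_mx A' b' *m (krylov_mx A b)^T).
  by split; [exact: OO|split; [exact: AO|left]].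
split.
  move=> k /andP[k1 kn]; have kn' : (k <= n)%N by lia.
  by split; [exact: cvg_Pi|exact: cvg_dPi].
split; first exact: jacobi_decomposition.
split; first exact: norm2_b_ell.
split.
  move=> A' b' A's A'b' e1 P1; apply: outer_eq_sign.
  have E' := outer_b_Pi0 A' b' A'b' A's n_gt0; rewrite e1 P1 in E'.
  exact: etrans (outer_b_Pi0 A b Ab_kalman A_sym n_gt0) (esym E').
split; first exact: kalmanN.
split; last by move=> T _; exact: gramianN.
move=> bb; have b0 := kalman_neq0 A b Ab_kalman n_gt0.
move/eqP: bb; rewrite eq_sym -subr_eq0 opprK -mulr2n -scaler_nat scaler_eq0.
by rewrite pnatr_eq0 (negbTE b0).
Qed.
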